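(* Let $M$ be an $n$-manifold and $G\colon M\to\mathbb G_{n+1}$ be an immersion. Then $G$ is Lagrangian if and only if for every $p\in M$ there exist a neighbourhood $U$ of $p$ and an immersion $\sigma\colon U\to\mathbb H^{n+1}$ such that $G_\sigma=G|_U$ (for some orientation of $U$).
   Context: $\mathbb H^{n+1}=\{x\in\mathbb R^{n+1,1}\mid\langle x,x\rangle=-1,\ x_{n+2}>0\}$ with $\langle x,y\rangle=\sum_{i\le n+1}x_iy_i-x_{n+2}y_{n+2}$; $T^1\mathbb H^{n+1}=\{(x,v)\mid x\in\mathbb H^{n+1},\ \langle x,v\rangle=0,\ \langle v,v\rangle=1\}$. $\mathbb G_{n+1}$ is the $2n$-manifold of oriented maximal unparametrized geodesics of $\mathbb H^{n+1}$, and $\mathrm p\colon T^1\mathbb H^{n+1}\to\mathbb G_{n+1}$ sends $(x,v)$ to the oriented geodesic through $x$ tangent to $v$; it is the quotient by the geodesic flow $\varphi_t(x,v)=(\cosh t\,x+\sinh t\,v,\ \sinh t\,x+\cosh t\,v)$, with generator $\chi_{(x,v)}=(v,x)$. For $w\in T_x\mathbb H^{n+1}$ with $\langle w,v\rangle=0$, let $w^{\mathcal H}=(w,0)$ and $w^{\mathcal V}=(0,w)$ in $T_{(x,v)}T^1\mathbb H^{n+1}$. The differential $d\mathrm p$ restricts to an isomorphism from the span $\chi_{(x,v)}^\perp$ of such vectors onto $T_{\mathrm p(x,v)}\mathbb G_{n+1}$, and the para-Kähler structure $(\mathbf g,\mathbb J,\Omega)$ of $\mathbb G_{n+1}$ is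 (well) defined by $\mathbf g(d\mathrm p(w_1^{\mathcal H}+u_1^{\mathcal V}),d\mathrm p(w_2^{\mathcal H}+u_2^{\mathcal V}))=\langle w_1,w_2\rangle-\langle u_1,u_2\rangle$, $\mathbb J\,d\mathrm p(w^{\mathcal H}+u^{\mathcal V})=d\mathrm p(u^{\mathcal H}+w^{\mathcal V})$, $\Omega(X,Y)=\mathbf g(X,\mathbb JY)$. An immersion $G$ of an $n$-manifold is Lagrangian if $G^*\Omega=0$. The Gauss map of an immersion $\sigma\colon U\to\mathbb H^{n+1}$ of an oriented $n$-manifold is $G_\sigma(p)=\mathrm p(\sigma(p),\nu(p))$, with $\nu$ the unit normal field compatible with the orientations of $U$ and $\mathbb H^{n+1}$. *)

(* Defs.v *)
From HB Require Import structures.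
From mathcomp Require Import all_boot all_order all_algebra.
From mathcomp Require Import all_classical all_reals all_analysis.
Set Implicit Arguments.
Unset Strict Implicit.
Unset Printing Implicit Defensive.
Import Order.TTheory GRing.Theory Num.Theory.
Import numFieldNormedType.Exports.
Local Open Scope classical_set_scope.
Local Open Scope ring_scope.

(* C^k and C^infty maps; only used with [O] open. *)
Fixpoint Ck (R : realType) (V W : normedModType R) (k : nat) (O : set V)
    (f : V -> W) : Prop :=
  match k with
  | 0 => forall x, O x -> {for x, continuous f}
  | k'.+1 => (forall x, O x -> differentiable f x) /\
             (forall v : V, Ck k' O (fun x => 'D_v f x))
  end.

Definition smooth_on (R : realType) (V W : normedModType R) (O : set V)
    (f : V -> W) : Prop :=
  forall k, Ck k O f.

(* [F] is a smooth extension of [f], given on the subset [S] of a vector space,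
   to a neighbourhood [O] of [y].  A map on an embedded submanifold [S] is smooth
   at [y] iff such an extension exists, and its differential on tangent vectors
   of [S] is that of any extension. *)
Definition extension_at (R : realType) (V W : normedModType R) (S : set V)
    (f : V -> W) (y : V) (O : set V) (F : V -> W) : Prop :=
  [/\ open O, O y, smooth_on O F & forall z, O z -> S z -> F z = f z].

Definition sub_diff (R : realType) (V W : normedModType R) (S : set V)
    (f : V -> W) (y xi : V) : W :=
  xget 0 [set a | exists (O : set V) (F : V -> W),
                    extension_at S f y O F /\ a = 'd F y xi].

(* [chart_map] is only meaningful on [chart_dom], and [chart_inv] on
   [chart_img]. *)
Record chart (R : realType) (T : Type) (d : nat) := Chart {
  chart_dom : set T;
  chart_map : T -> 'rV[R]_d;
  chart_inv : 'rV[R]_d -> T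
}.

Definition chart_img (R : realType) (T : Type) (d : nat) (phi : chart R T d) :
    set 'rV[R]_d :=
  chart_map phi @` chart_dom phi.

Definition transition (R : realType) (T : Type) (d : nat) (phi psi : chart R T d) :
    'rV[R]_d -> 'rV[R]_d :=
  chart_map psi \o chart_inv phi.

Definition is_homeo_chart (R : realType) (T : topologicalType) (d : nat)
    (phi : chart R T d) : Prop :=
  [/\ open (chart_dom phi), open (chart_img phi),
      {within chart_dom phi, continuous (chart_map phi)},
      {within chart_img phi, continuous (chart_inv phi)} &
      forall p, chart_dom phi p -> chart_inv phi (chart_map phi p) = p].

Record manifold (R : realType) (n : nat) := Manifold {
  carrier :> topologicalType;
  atlas : set (chart R carrier n);
  manifold_hausdorff : hausdorff_space carrier;
  manifold_second_countable : @second_countable carrier;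
  manifold_charts : forall phi, atlas phi -> is_homeo_chart phi;
  manifold_cover : forall p : carrier, exists2 phi, atlas phi & chart_dom phi p;
  manifold_compatible : forall phi psi, atlas phi -> atlas psi ->
    smooth_on (chart_map phi @` (chart_dom phi `&` chart_dom psi))
              (transition phi psi)
}.

Definition vector_atlas (R : realType) (d : nat) : set (chart R 'rV[R]_d d) :=
  [set Chart setT id id].

(* A map read in a chart of the source and one of the target. *)
Definition local_rep (R : realType) (S T : Type) (n d : nat) (phi : chart R S n)
    (psi : chart R T d) (f : S -> T) : 'rV[R]_n -> 'rV[R]_d :=
  chart_map psi \o f \o chart_inv phi.

Definition smooth_map (R : realType) (S T : Type) (n d : nat)
    (A : set (chart R S n)) (B : set (chart R T d)) (U : set S) (f : S -> T) : Prop :=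
  forall p, U p -> exists phi psi (O : set 'rV[R]_n),
    [/\ A phi, B psi & chart_dom phi p] /\
    [/\ open O, O (chart_map phi p), O `<=` chart_img phi,
        (forall z, O z -> chart_dom psi (f (chart_inv phi z))) &
        smooth_on O (local_rep phi psi f)].

(* A tangent vector at a point is represented, in a chart around that point, by
   its coordinate vector. *)
Definition tangent_map (R : realType) (S T : Type) (n d : nat) (phi : chart R S n)
    (psi : chart R T d) (f : S -> T) (p : S) (X : 'rV[R]_n) : 'rV[R]_d :=
  'd (local_rep phi psi f) (chart_map phi p) X.

Definition immersion (R : realType) (S T : Type) (n d : nat)
    (A : set (chart R S n)) (B : set (chart R T d)) (U : set S) (f : S -> T) : Prop :=
  smooth_map A B U f /\
  forall p phi psi, U p -> A phi -> B psi ->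
    chart_dom phi p -> chart_dom psi (f p) -> injective (tangent_map phi psi f p).

(* An orientation of the open set [U]: [o phi p] is 1 or -1 according to whether
   the coordinate frame of [phi] at [p] is positive or negative. *)
Definition orientation (R : realType) (n : nat) (M : manifold R n) (U : set M)
    (o : chart R M n -> M -> R) : Prop :=
  [/\ forall phi p, atlas phi -> U p -> chart_dom phi p ->
        o phi p = 1 \/ o phi p = -1,
      forall phi p, atlas phi -> U p -> chart_dom phi p ->
        \forall q \near p, o phi q = o phi p &
      forall phi psi p, atlas phi -> atlas psi -> U p ->
        chart_dom phi p -> chart_dom psi p ->
        o phi p = Num.sg (\det ('J (transition phi psi) (chart_map phi p))) * o psi p].

Section Hyperbolic.
Variables (R : realType) (n : nat).

Notation V := 'rV[R]_n.+2.
Notation VV := (V * V)%type.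

(* The Minkowski product; the timelike coordinate x_{n+2} has index [ord_max]. *)
Definition mink (x y : V) : R :=
  \sum_(i < n.+2 | i != ord_max) x 0 i * y 0 i - x 0 ord_max * y 0 ord_max.

Definition hyperbolic_space : set V :=
  [set x | mink x x = -1 /\ 0 < x 0 ord_max].

Definition unit_tangent : set VV :=
  [set y | [/\ hyperbolic_space y.1, mink y.1 y.2 = 0 & mink y.2 y.2 = 1]].

Definition cosh (t : R) : R := (expR t + expR (- t)) / 2.
Definition sinh (t : R) : R := (expR t - expR (- t)) / 2.

Definition geodesic_flow (t : R) (y : VV) : VV :=
  (cosh t *: y.1 + sinh t *: y.2, sinh t *: y.1 + cosh t *: y.2).

(* An oriented maximal unparametrized geodesic is identified with the set of its
   unit tangent vectors, an orbit of the geodesic flow. *)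
Definition proj (y : VV) : set VV := [set z | exists t, z = geodesic_flow t y].

Definition geodesics : set (set VV) := proj @` unit_tangent.

(* The quotient smooth structure: the charts [psi] such that [psi \o proj] is
   smooth and the inverse of [psi] lifts locally to smooth maps into the unit
   tangent bundle. *)
Definition geodesic_atlas : set (chart R (set VV) (n + n)) :=
  [set psi |
    [/\ chart_dom psi `<=` geodesics,
        open (chart_img psi) &
        forall q, chart_dom psi q -> chart_inv psi (chart_map psi q) = q] /\
    (forall y, unit_tangent y -> chart_dom psi (proj y) ->
       exists (O : set VV) (F : VV -> 'rV[R]_(n + n)),
         extension_at unit_tangent (chart_map psi \o proj) y O F /\
         forall z, O z -> unit_tangent z -> chart_dom psi (proj z)) /\
    (forall a, chart_img psi a ->
       exists (O : set 'rV[R]_(n + n)) (s : 'rV[R]_(n + n) -> VV),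
         [/\ open O, O a, O `<=` chart_img psi, smooth_on O s &
             forall b, O b -> unit_tangent (s b) /\ proj (s b) = chart_inv psi b])].

(* The differential of [proj] at [y], with values read in the chart [psi]. *)
Definition dproj (psi : chart R (set VV) (n + n)) (y xi : VV) : 'rV[R]_(n + n) :=
  sub_diff unit_tangent (chart_map psi \o proj) y xi.

(* The orthogonal of the generator of the flow; (w, u) is w^H + u^V. *)
Definition chi_orth (y : VV) : set VV :=
  [set xi | [/\ mink xi.1 y.1 = 0, mink xi.1 y.2 = 0,
                mink xi.2 y.1 = 0 & mink xi.2 y.2 = 0]].

Definition hor_lift (psi : chart R (set VV) (n + n)) (y : VV)
    (X : 'rV[R]_(n + n)) : VV :=
  xget 0 [set xi | chi_orth y xi /\ dproj psi y xi = X].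

(* A unit tangent vector of the geodesic [q]; the tensors below do not depend on
   its choice. *)
Definition rep (q : set VV) : VV := xget 0 [set y | unit_tangent y /\ proj y = q].

(* The para-Kaehler structure at [q], on coordinate vectors in the chart [psi]. *)
Definition para_metric (psi : chart R (set VV) (n + n)) (q : set VV)
    (X Y : 'rV[R]_(n + n)) : R :=
  let xi := hor_lift psi (rep q) X in
  let eta := hor_lift psi (rep q) Y in
  mink xi.1 eta.1 - mink xi.2 eta.2.

Definition para_complex (psi : chart R (set VV) (n + n)) (q : set VV)
    (X : 'rV[R]_(n + n)) : 'rV[R]_(n + n) :=
  let xi := hor_lift psi (rep q) X in dproj psi (rep q) (xi.2, xi.1).

Definition para_symplectic (psi : chart R (set VV) (n + n)) (q : set VV)
    (X Y : 'rV[R]_(n + n)) : R :=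
  para_metric psi q X (para_complex psi q Y).

Definition lagrangian (M : manifold R n) (G : M -> set VV) : Prop :=
  forall (p : M) phi psi, atlas phi -> geodesic_atlas psi ->
    chart_dom phi p -> chart_dom psi (G p) ->
    forall X Y : 'rV[R]_n,
      para_symplectic psi (G p) (tangent_map phi psi G p X)
                                (tangent_map phi psi G p Y) = 0.

(* The differential of a map into Minkowski space, in a chart of the source. *)
Definition diff_in (M : manifold R n) (phi : chart R M n) (s : M -> V) (p : M)
    (X : 'rV[R]_n) : V :=
  'd (s \o chart_inv phi) (chart_map phi p) X.

(* Rows: the images of the coordinate vectors of [phi], then [nu], then [s p]. *)
Definition frame_mx (M : manifold R n) (phi : chart R M n) (s : M -> V) (nu : V)
    (p : M) : 'M[R]_n.+2 :=
  \matrix_(i < n.+2)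
    if unlift ord_max i is Some j then
      if unlift ord_max j is Some k then diff_in phi s p (delta_mx 0 k) else nu
    else s p.

(* The orientation of the hyperbolic space is the one for which a basis
   w_1, .., w_{n+1} of the tangent space at x is positive iff
   det (w_1, .., w_{n+1}, x) > 0; the unit normal is the one completing positive
   frames of [M] to positive frames. *)
Definition unit_normal (M : manifold R n) (o : chart R M n -> M -> R) (s : M -> V)
    (p : M) : V :=
  xget 0 [set nu |
    [/\ mink nu (s p) = 0, mink nu nu = 1 &
        forall phi, atlas phi -> chart_dom phi p ->
          (forall X, mink nu (diff_in phi s p X) = 0) /\
          0 < o phi p * \det (frame_mx phi s nu p)]].

Definition gauss_map (M : manifold R n) (o : chart R M n -> M -> R) (s : M -> V)
    (p : M) : set VV :=
  proj (s p, unit_normal o s p).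

End Hyperbolic.

(* Main.v *)
From HB Require Import structures.
From mathcomp Require Import all_boot all_order all_algebra.
From mathcomp Require Import all_classical all_reals all_analysis.
From mathcomp Require Import perm ring lra.
Require Import Defs.
Set Implicit Arguments.
Unset Strict Implicit.
Unset Printing Implicit Defensive.
Import Order.TTheory GRing.Theory Num.Theory.
Import numFieldNormedType.Exports.
Local Open Scope classical_set_scope.
Local Open Scope ring_scope.

(** Everything is computed upstairs, on the unit tangent bundle. Locally [G] is
    [proj] of a smooth lift [(a, b)] (lemma [local_lift]), and the symplectic form
    pulls back along any lift to
    [omega (xi, eta) = mink xi.1 eta.2 - mink xi.2 eta.1], which is, up to sign, the
    differential of the Liouville form [mink b (da)] (lemma [para_symplectic_lift]).
    So [G] is Lagrangian iff the Liouville form of its local lifts is closed.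

    If [G] is the Gauss map of [sigma], the lift [(sigma, nu)] has zero Liouville
    form, since [nu] is normal to [sigma]; a zero form is closed
    ([normal_lift_omega], where closedness amounts to the symmetry of the second
    derivatives of [sigma]).

    Conversely, if the Liouville form of [(a, b)] is closed, it has a primitive [f]
    on a ball by Poincare's lemma ([poincare]). Moving each base point along its
    geodesic by the time [t = c - f] does not change the geodesic and adds [dt] to
    the Liouville form ([liouville_flow]), which becomes zero: the velocity of the
    translated lift is normal to its base point map [sigma]. It remains to choose
    the constant [c] so that [sigma] is an immersion at the given point. The
    differentials of the base point and of the velocity there, taken modulo the flow
    direction, form a pair [(A, B)] whose joint kernel is zero, as [G] is an
    immersion, and such that [mink (A v) (B w)] is symmetric, as [G] is
    Lagrangian. The differential of [sigma] is [cosh c *: A + sinh c *: B], which is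
    injective for all but at most [n] values of [c] ([transverse_translate]). The
    orientation is the sign of the determinant of the frame made of the differential
    of [sigma], the velocity and the base point ([gauss_of_normal_field]).

    The tensors on the space of geodesics are defined through arbitrary choices: an
    extension of a chart composed with [proj], a representative of a geodesic, and a
    lift of a tangent vector. These choices are eliminated by [vanish_tangent] and
    [extension_injective], which say that a map given on the unit tangent bundle has
    a well defined differential on the tangent vectors orthogonal to the flow
    direction, and that the differential of [proj] is injective on them. *)

(** * Differentials *)

Lemma differentiable_eps (R : realType) (V W : normedModType R) (f : V -> W) x
    (e : R) : differentiable f x -> 0 < e ->
  \forall h \near 0, `|f (h + x) - f x - 'd f x h| <= e * `|h|.
Proof.
move=> /diff_locally /eqaddoP /(_ e) H /H; apply: filterS => h.
by rewrite !fctE /= opprD addrA.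
Qed.

Lemma eps_differentiable (R : realType) (V W : normedModType R) (f : V -> W) x
    (L : {linear V -> W}) : continuous L ->
  (forall e : R, 0 < e ->
     \forall h \near 0, `|f (h + x) - f x - L h| <= e * `|h|) ->
  differentiable f x /\ 'd f x = L :> (V -> W).
Proof.
move=> cL H.
have E : f \o shift x = cst (f x) + L +o_ 0 id.
  apply/eqaddoP => e /H; apply: filterS => h.
  by rewrite !fctE /= opprD addrA.
have D := diff_unique cL E; split=> //.
by apply/diff_locallyP; rewrite D.
Qed.

Lemma near_differentiable (R : realType) (V W : normedModType R) (f g : V -> W) x :
  (\forall z \near x, f z = g z) -> differentiable f x ->
  differentiable g x /\ 'd g x = 'd f x :> (V -> W).
Proof.
move=> fg df; apply: eps_differentiable.
  exact: diff_continuous.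
move=> e e0; near=> h.
rewrite -(nbhs_singleton fg) -(_ : f (h + x) = g (h + x)).
  by near: h; apply: differentiable_eps.
near: h; move: fg; rewrite (near_shift 0 x) /= .
by apply: filterS => h; rewrite /= subr0.
Unshelve. all: by end_near. Qed.

Lemma diff_compE (R : realType) (U V W : normedModType R) (f : U -> V) (g : V -> W)
    x v : differentiable f x -> differentiable g (f x) ->
  'd (g \o f) x v = 'd g (f x) ('d f x v).
Proof. by move=> df dg; rewrite diff_comp. Qed.

Lemma diff_cstE (R : realType) (V W : normedModType R) (a : W) (x v : V) :
  'd (cst a) x v = 0.
Proof. by rewrite diff_cst. Qed.

Lemma diffDE (R : realType) (V W : normedModType R) (f g : V -> W) x v :
  differentiable f x -> differentiable g x ->
  'd (fun z => f z + g z) x v = 'd f x v + 'd g x v.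
Proof. by move=> df dg; exact: (congr1 (@^~ v) (diffD df dg)). Qed.

Lemma diffBE (R : realType) (V W : normedModType R) (f g : V -> W) x v :
  differentiable f x -> differentiable g x ->
  'd (fun z => f z - g z) x v = 'd f x v - 'd g x v.
Proof. by move=> df dg; exact: (congr1 (@^~ v) (diffB df dg)). Qed.

Lemma diff_pairE (R : realType) (U V W : normedModType R) (f : U -> V) (g : U -> W)
    x v : differentiable f x -> differentiable g x ->
  'd (fun z => (f z, g z)) x v = ('d f x v, 'd g x v).
Proof. by move=> df dg; rewrite diff_pair. Qed.

Lemma diff_linE (R : realType) (U V W : normedModType R) (L : {linear V -> W})
    (f : U -> V) x v : continuous L -> differentiable f x ->
  'd (fun z => L (f z)) x v = L ('d f x v).
Proof.
move=> cL df; have dL : differentiable L (f x) by exact: linear_differentiable.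
by rewrite (diff_compE (g := L)) // diff_lin.
Qed.

Lemma differentiable_lin (R : realType) (U V W : normedModType R)
    (L : {linear V -> W}) (f : U -> V) x : continuous L -> differentiable f x ->
  differentiable (fun z => L (f z)) x.
Proof.
by move=> cL df; apply: (differentiable_comp (g := L)) => //; exact: linear_differentiable.
Qed.

Lemma differentiable_fst (R : realType) (U V W : normedModType R) (f : U -> V * W) x :
  differentiable f x -> differentiable (fun z => (f z).1) x.
Proof.
by move=> df; apply: (differentiable_lin (L := fst)) => //; move=> ?; exact: cvg_fst.
Qed.

Lemma differentiable_snd (R : realType) (U V W : normedModType R) (f : U -> V * W) x :
  differentiable f x -> differentiable (fun z => (f z).2) x.
Proof.
by move=> df; apply: (differentiable_lin (L := snd)) => //; move=> ?; exact: cvg_snd.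
Qed.

Lemma diff_fstE (R : realType) (U V W : normedModType R) (f : U -> V * W) x v :
  differentiable f x -> 'd (fun z => (f z).1) x v = ('d f x v).1.
Proof.
by move=> df; apply: (diff_linE (L := fst)) => //; move=> ?; exact: cvg_fst.
Qed.

Lemma diff_sndE (R : realType) (U V W : normedModType R) (f : U -> V * W) x v :
  differentiable f x -> 'd (fun z => (f z).2) x v = ('d f x v).2.
Proof.
by move=> df; apply: (diff_linE (L := snd)) => //; move=> ?; exact: cvg_snd.
Qed.

Lemma differentiable_bil (R : realType) (U V V' W : normedModType R)
    (B : {bilinear V -> V' -> W}) (f : U -> V) (g : U -> V') x :
  continuous (fun p => B p.1 p.2) -> differentiable f x -> differentiable g x ->
  differentiable (fun z => B (f z) (g z)) x.
Proof.
move=> cB df dg.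
apply: (differentiable_comp (f := fun z => (f z, g z)) (g := fun p => B p.1 p.2)).
  exact: differentiable_pair.
exact: differentiable_bilin.
Qed.

Lemma diff_bilE (R : realType) (U V V' W : normedModType R)
    (B : {bilinear V -> V' -> W}) (f : U -> V) (g : U -> V') x v :
  continuous (fun p => B p.1 p.2) -> differentiable f x -> differentiable g x ->
  'd (fun z => B (f z) (g z)) x v = B ('d f x v) (g x) + B (f x) ('d g x v).
Proof.
move=> cB df dg.
have dp : differentiable (fun z => (f z, g z)) x by exact: differentiable_pair.
rewrite (diff_compE (f := fun z => (f z, g z)) (g := fun p => B p.1 p.2)) //.
  by rewrite diff_bilin // diff_pair //= addrC.
exact: differentiable_bilin.
Qed.

Lemma scale_is_bilinear (R : realType) (W : normedModType R) :
  bilinear_for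
    (GRing.Scale.Law.clone _ _ *:%R _) (GRing.Scale.Law.clone _ _ *:%R _)
    (@GRing.scale R W : R -> W -> W).
Proof.
split=> [u'|u] a x y /=.
- by rewrite scalerDl scalerA.
- by rewrite scalerDr !scalerA mulrC.
Qed.

HB.instance Definition _ (R : realType) (W : normedModType R) :=
  bilinear_isBilinear.Build R R W W _ _ (@GRing.scale R W)
    (@scale_is_bilinear R W).

Lemma scale_bil_continuous (R : realType) (W : normedModType R) :
  continuous (fun p : R * W => p.1 *: p.2).
Proof. by move=> p; exact: scale_continuous. Qed.

Lemma diff_scaleE (R : realType) (U V : normedModType R)
    (k : U -> R) (f : U -> V) x v : differentiable k x -> differentiable f x ->
  differentiable (fun z => k z *: f z) x /\
  'd (fun z => k z *: f z) x v = 'd k x v *: f x + k x *: 'd f x v.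
Proof.
move=> df dg; have c := @scale_bil_continuous R V.
by split; [exact: (differentiable_bil (B := @GRing.scale R V))
  |exact: (diff_bilE (B := @GRing.scale R V))].
Qed.

Lemma diff_scale_comb (R : realType) (V : normedModType R) (a b : R -> R) (x w : V) r s :
  differentiable a r -> differentiable b r ->
  differentiable (fun r => a r *: x + b r *: w) r /\
  'd (fun r => a r *: x + b r *: w) r s = 'd a r s *: x + 'd b r s *: w.
Proof.
move=> da db; have D1 := differentiableZl x da; have D2 := differentiableZl w db.
split; first exact: (differentiableD D1 D2).
by apply: etrans (congr1 (@^~ s) (diffD D1 D2)) _; rewrite /= !diffZl.
Qed.

(** Entries are packaged as functions so that they carry a linear structure. *)
Definition entry (R : realType) (m : nat) (i : 'I_m) (w : 'rV[R]_m) : R := w 0 i.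

Lemma entry_is_linear (R : realType) (m : nat) (i : 'I_m) :
  linear (@entry R m i : 'rV[R]_m -> R).
Proof. by move=> a x y; rewrite /entry !mxE. Qed.

HB.instance Definition _ (R : realType) (m : nat) (i : 'I_m) :=
  GRing.isLinear.Build R 'rV[R]_m R _ (@entry R m i) (@entry_is_linear R m i).

Lemma entry_continuous (R : realType) (m : nat) (i : 'I_m) :
  continuous (@entry R m i).
Proof. exact: coord_continuous. Qed.

Lemma row_sum_entry (R : realType) (m : nat) (w : 'rV[R]_m) :
  w = \sum_i entry i w *: delta_mx 0 i.
Proof. by rewrite {1}[w]row_sum_delta. Qed.

Lemma linear_rV_sum (R : realType) (m : nat) (W : lmodType R)
    (L : {linear 'rV[R]_m -> W}) w :
  L w = \sum_i entry i w *: L (delta_mx 0 i).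
Proof.
rewrite {1}[w]row_sum_entry linear_sum; apply: eq_bigr => i _.
by rewrite linearZ.
Qed.

(** * Smooth maps *)

Lemma Ck_ext (R : realType) (V W : normedModType R) k (O : set V) (f g : V -> W) :
  open O -> (forall x, O x -> f x = g x) -> Ck k O f -> Ck k O g.
Proof.
move=> oO; have nO x : O x -> \forall z \near x, O z by move=> Ox; apply: open_nbhs_nbhs.
elim: k f g => [|k IH] f g fg /=.
  move=> cf x Ox; have cfx : f z @[z --> x] --> g x.
    by rewrite -(fg x Ox); exact: cf.
  apply: cvg_trans cfx; apply: near_eq_cvg.
  by near=> z; apply: fg; near: z; exact: nO.
have D x : O x -> \forall z \near x, f z = g z.
  by move=> Ox; near=> z; apply: fg; near: z; exact: nO.
move=> [df cdf]; split=> [x Ox|v].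
  by have [] := near_differentiable (D x Ox) (df x Ox).
apply: (IH (fun x => 'D_v f x)) => // x Ox.
exact: near_eq_derive (D x Ox).
Unshelve. all: by end_near. Qed.

Lemma Ck_sub (R : realType) (V W : normedModType R) k (O O' : set V) (f : V -> W) :
  O' `<=` O -> Ck k O f -> Ck k O' f.
Proof.
move=> OO; elim: k f => [|k IH] f /=; first by move=> H x /OO; exact: H.
by move=> [df cdf]; split=> [x /OO|v]; [exact: df|exact: IH].
Qed.

Lemma Ck_pred (R : realType) (V W : normedModType R) k (O : set V) (f : V -> W) :
  Ck k.+1 O f -> Ck k O f.
Proof.
elim: k f => [|k IH] f /=.
  by move=> [df _] x Ox; apply: differentiable_continuous; exact: df.
by move=> [df cdf]; split=> // v; apply: IH; exact: cdf.
Qed.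

Lemma smooth_differentiable (R : realType) (V W : normedModType R) (O : set V) (f : V -> W) :
  smooth_on O f -> forall x, O x -> differentiable f x.
Proof. by move=> /(_ 1) []. Qed.

Lemma smooth_derive (R : realType) (V W : normedModType R) (O : set V) (f : V -> W) :
  smooth_on O f -> forall v, smooth_on O (fun x => 'D_v f x).
Proof. by move=> sf v k; have [_] := sf k.+1; exact. Qed.

Lemma smooth_continuous (R : realType) (V W : normedModType R) (O : set V) (f : V -> W) :
  smooth_on O f -> forall x, O x -> {for x, continuous f}.
Proof. by move=> /(_ 0). Qed.

Lemma smooth_of_derive (R : realType) (V W : normedModType R) (O : set V) (f : V -> W) :
  (forall x, O x -> differentiable f x) -> (forall v, smooth_on O ('D_v f)) ->
  smooth_on O f.
Proof.
move=> df sdf [|k]; first by move=> x Ox; apply: differentiable_continuous; exact: df.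
by split=> // v; exact: sdf.
Qed.

Lemma Ck_cst (R : realType) (V W : normedModType R) k (O : set V) (c : W) :
  Ck k O (fun _ : V => c).
Proof.
elim: k c => [|k IH] c /=; first by move=> x _; exact: cst_continuous.
split=> [x _|v]; first exact: differentiable_cst.
have -> : (fun x => 'D_v (fun _ : V => c) x) = (fun _ : V => 0 : W).
  by apply/funext => x; exact: derive_cst.
exact: IH.
Qed.

Lemma Ck_lin (R : realType) (U V W : normedModType R) (L : {linear V -> W}) k
    (O : set U) (f : U -> V) : open O -> continuous L ->
  Ck k O f -> Ck k O (fun z => L (f z)).
Proof.
move=> oO cL; elim: k f => [|k IH] f /=.
  by move=> cf x Ox; apply: continuous_comp; [exact: cf|exact: cL].
move=> [df cdf]; split=> [x Ox|v].
  by apply: differentiable_lin => //; exact: df.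
apply: Ck_ext (IH _ (cdf v)) => // x Ox.
rewrite !deriveE; [|by apply: differentiable_lin => //; exact: df|exact: df].
by rewrite diff_linE //; exact: df.
Qed.

Lemma Ck_add (R : realType) (V W : normedModType R) k (O : set V) (f g : V -> W) :
  open O -> Ck k O f -> Ck k O g -> Ck k O (fun z => f z + g z).
Proof.
move=> oO; elim: k f g => [|k IH] f g /=.
  by move=> cf cg x Ox; apply: continuousD; [exact: cf|exact: cg].
move=> [df cdf] [dg cdg]; split=> [x Ox|v].
  by apply: differentiableD; [exact: df|exact: dg].
apply: Ck_ext (IH _ _ (cdf v) (cdg v)) => // x Ox /=.
by rewrite deriveD //; apply: diff_derivable; [exact: df|exact: dg].
Qed.

Lemma Ck_sum (R : realType) (V W : normedModType R) k (O : set V) (I : Type)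
    (r : seq I) (f : I -> V -> W) : open O ->
  (forall i, Ck k O (f i)) -> Ck k O (fun z => \sum_(i <- r) f i z).
Proof.
move=> oO cf; elim: r => [|i r IH].
  by apply: Ck_ext (@Ck_cst _ _ _ k O 0) => // x _; rewrite big_nil.
by apply: Ck_ext (Ck_add oO (cf i) IH) => // x _; rewrite big_cons.
Qed.

(** By the Leibniz rule the derivative of a bilinear expression is a sum of
    two expressions of the same kind, with one derivative less to spare on
    one side. *)
Lemma Ck_bil (R : realType) (U V V' W : normedModType R)
    (B : {bilinear V -> V' -> W}) k (O : set U) (f : U -> V) (g : U -> V') :
  open O -> continuous (fun p => B p.1 p.2) ->
  Ck k O f -> Ck k O g -> Ck k O (fun z => B (f z) (g z)).
Proof.
move=> oO cB; elim: k f g => [|k IH] f g.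
  move=> /= cf cg x Ox.
  apply: (continuous_comp (f := fun z => (f z, g z)) (g := fun p => B p.1 p.2)).
    by apply: cvg_pair; [exact: cf|exact: cg].
  exact: cB.
move=> Cf Cg; have [df cdf] := Cf; have [dg cdg] := Cg; split=> [x Ox|v].
  by apply: differentiable_bil => //; [exact: df|exact: dg].
apply: Ck_ext (Ck_add oO (IH _ _ (cdf v) (Ck_pred Cg))
                         (IH _ _ (Ck_pred Cf) (cdg v))) => // x Ox.
have dfx := df x Ox; have dgx := dg x Ox.
by rewrite !deriveE ?diff_bilE //; exact: differentiable_bil.
Qed.

Lemma linear_rV_continuous (R : realType) (m : nat) (W : normedModType R)
    (L : {linear 'rV[R]_m -> W}) : continuous L.
Proof.
have -> : (L : _ -> _) = (fun w => \sum_i entry i w *: L (delta_mx 0 i)).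
  by apply/funext => w; exact: linear_rV_sum.
suff C : Ck 0 setT (fun w : 'rV[R]_m => \sum_i entry i w *: L (delta_mx 0 i)).
  by move=> w; exact: C.
apply: Ck_sum => [|i]; first exact: openT.
apply: (Ck_bil (B := @GRing.scale R W)); first exact: openT.
- exact: scale_bil_continuous.
- by move=> w _; exact: entry_continuous.
- exact: Ck_cst.
Qed.

(** The induction on [k] needs the derivative of [g \o f] as an expression
    of the same kind: on row vectors it is a sum over the coordinates of the
    products of the entries of ['D_v f] with the partial derivatives of [g],
    composed with [f]. *)
Lemma Ck_comp (R : realType) (U W : normedModType R) (m k : nat) (O : set U)
    (O' : set 'rV[R]_m) (f : U -> 'rV[R]_m) (g : 'rV[R]_m -> W) :
  open O -> open O' -> (forall x, O x -> O' (f x)) ->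
  Ck k O f -> Ck k O' g -> Ck k O (g \o f).
Proof.
move=> oO oO' fO; elim: k g => [|k IH] g.
  move=> cf cg x Ox; apply: continuous_comp; first exact: cf.
  by apply: cg; exact: fO.
move=> Cf [dg cdg]; have [df cdf] := Cf.
have dgf x : O x -> differentiable (g \o f) x.
  by move=> Ox; apply: differentiable_comp; [exact: df|apply: dg; exact: fO].
split=> // v.
apply: (@Ck_ext _ _ _ _ _
  (fun x => \sum_i entry i ('D_v f x) *: ('D_(delta_mx 0 i) g \o f) x)) => //.
  move=> x Ox; have dgx : differentiable g (f x) by apply: dg; exact: fO.
  have dfx := df x Ox; rewrite (deriveE v (dgf x Ox)) (deriveE v dfx).
  rewrite (diff_compE v dfx dgx).
  rewrite (linear_rV_sum ('d g (f x))).
  by apply: eq_bigr => i _ /=; rewrite deriveE.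
apply: Ck_sum => // i; apply: (Ck_bil (B := @GRing.scale R W)) => //.
- exact: scale_bil_continuous.
- by apply: (Ck_lin (L := @entry R m i)); [|exact: entry_continuous|exact: cdf].
- by apply: IH; [exact: Ck_pred|exact: cdg].
Qed.

Lemma smooth_comp (R : realType) (U W : normedModType R) (m : nat) (O : set U)
    (P : set 'rV[R]_m) (f : U -> 'rV[R]_m) (g : 'rV[R]_m -> W) :
  open O -> open P -> (forall x, O x -> P (f x)) ->
  smooth_on O f -> smooth_on P g -> smooth_on O (g \o f).
Proof. by move=> oO oP fO sf sg k; exact: Ck_comp oO oP fO (sf k) (sg k). Qed.

Lemma Ck_expR (R : realType) (U : normedModType R) k (O : set U) (f : U -> R) :
  open O -> Ck k O f -> Ck k O (fun z => expR (f z)).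
Proof.
move=> oO; elim: k f => [|k IH] f.
  move=> cf x Ox; apply: continuous_comp; first exact: cf.
  exact: continuous_expR.
move=> Cf; have [df cdf] := Cf.
have dE y : differentiable (@expR R) y by apply/derivable1_diffP.
split=> [x Ox|v]; first by apply: (differentiable_comp (g := @expR R)) => //; exact: df.
apply: Ck_ext (Ck_bil (B := @GRing.scale R R) oO (@scale_bil_continuous R R)
  (IH _ (Ck_pred Cf)) (cdf v)) => // x Ox.
rewrite !deriveE; [|by apply: (differentiable_comp (g := @expR R)) => //; exact: df|exact: df].
rewrite (diff_compE (g := @expR R)) //; last exact: df.
by rewrite deriv1E // derive1E derive_val /=; exact: mulrC.
Qed.

Lemma smooth_scale (R : realType) (U V : normedModType R) (O : set U)
    (k : U -> R) (f : U -> V) : open O -> smooth_on O k -> smooth_on O f ->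
  smooth_on O (fun z => k z *: f z).
Proof.
move=> oO sk sf j; apply: (Ck_bil (B := @GRing.scale R V)) => //.
exact: scale_bil_continuous.
Qed.

Lemma smooth_add (R : realType) (U V : normedModType R) (O : set U)
    (f g : U -> V) : open O -> smooth_on O f -> smooth_on O g ->
  smooth_on O (fun z => f z + g z).
Proof. by move=> oO sf sg k; exact: Ck_add oO (sf k) (sg k). Qed.

Lemma smooth_opp (R : realType) (U V : normedModType R) (O : set U)
    (f : U -> V) : open O -> smooth_on O f -> smooth_on O (fun z => - f z).
Proof.
move=> oO sf k; have sc := smooth_scale oO (fun j => Ck_cst j O (-1 : R)) sf.
by apply: Ck_ext (sc k) => // x _; rewrite scaleN1r.
Qed.

(** * Symmetry of second derivatives *)

Lemma line_derive (R : realType) (V W : normedModType R) (f : V -> W) x v (s : R) :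
  differentiable f (x + s *: v) ->
  is_derive s 1 (fun s => f (x + s *: v)) ('D_v f (x + s *: v)).
Proof.
move=> df.
have ds : differentiable ( *:%R^~ v : R -> V) s by exact: ex_diff.
have dl : differentiable (fun s : R => x + s *: v) s.
  exact: (differentiableD (differentiable_cst x s) ds).
have E : 'd (fun s : R => x + s *: v) s 1 = v.
  rewrite (diffD (differentiable_cst x s) ds) diff_cst.
  by rewrite /= diff_val scale1r add0r.
have dc : differentiable (f \o (fun s : R => x + s *: v)) s.
  by apply: differentiable_comp.
apply: DeriveDef; first exact: diff_derivable.
by rewrite (deriveE (1 : R) dc) (deriveE v df) (diff_compE (1 : R) dl df) E.
Qed.

(** The mean value theorem in the direction [v] reduces the second
    difference of [f], over the parallelogram spanned by [h *: v] and [h *: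
    w], to an increment of ['D_v f], to which differentiability at [x]
    applies. *)
Lemma second_difference (R : realType) (V : normedModType R) (f : V -> R) x v w :
  (\forall z \near x, differentiable f z) -> differentiable ('D_v f) x ->
  forall e : R, 0 < e -> \forall h \near 0^'+,
    `|f (x + h *: v + h *: w) - f (x + h *: v) - f (x + h *: w) + f x
      - h ^+ 2 * 'D_w ('D_v f) x| <= e * h ^+ 2.
Proof.
move=> dfn ddf e e0.
(* the increments from [x] met below are [c *: v + h *: w] and [c *: v], with
   [c <= h] *)
pose C := 2 * `|v| + `|w| + 1.
have C0 : 0 < C by rewrite /C; have := normr_ge0 v; have := normr_ge0 w; lra.
have eC : 0 < e / C by rewrite divr_gt0.
have H := differentiable_eps ddf eC.
have {}dfn : \forall k \near 0, differentiable f (k + x).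
  by move: dfn; rewrite (near_shift 0 x); apply: filterS => k; rewrite /= subr0.
have [r /= r0 rP] := (nbhs_ballP _ _).1 (filterI dfn H).
near=> h.
have h0 : 0 < h by near: h; exact: nbhs_right_gt.
have hC : h * C < r.
  rewrite -ltr_pdivlMr //; near: h; apply: nbhs_right_lt.
  exact: divr_gt0.
have B1 s t : 0 <= s <= h -> 0 <= t <= h -> `|s *: v + t *: w| <= h * (`|v| + `|w|).
  move=> /andP[s0 sh] /andP[t0 th]; rewrite (le_trans (ler_normD _ _)) //.
  by rewrite !normrZ !ger0_norm // mulrDr lerD // ler_wpM2r.
have B s t : 0 <= s <= h -> 0 <= t <= h -> ball 0 r (s *: v + t *: w).
  move=> sh th; rewrite -ball_normE /= sub0r normrN.
  apply: le_lt_trans hC; apply: le_trans (B1 _ _ sh th) _.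
  by rewrite ler_wpM2l ?(ltW h0) // /C; have := normr_ge0 v; lra.
pose u s := f (x + h *: w + s *: v) - f (x + s *: v).
have du s : 0 <= s <= h ->
    is_derive s 1 u ('D_v f (x + h *: w + s *: v) - 'D_v f (x + s *: v)).
  move=> sh; apply: is_deriveB; apply: line_derive.
    have := B s h sh; rewrite (ltW h0) lexx => /(_ isT) /rP [+ _].
    by rewrite [_ + x]addrC [s *: v + _]addrC addrA.
  have := B s 0 sh; rewrite (ltW h0) lexx => /(_ isT) /rP [+ _].
  by rewrite scale0r addr0 addrC.
have [c ch Ec] : exists2 c, c \in `]0, h[%R & u h - u 0 =
    ('D_v f (x + h *: w + c *: v) - 'D_v f (x + c *: v)) * (h - 0).
  apply: MVT => //.
    by move=> s; rewrite in_itv /= => /andP[s0 sh]; apply: du; rewrite !ltW.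
  apply: derivable_within_continuous => s; rewrite in_itv /= => sh.
  by have [] := du s sh.
move: ch; rewrite in_itv /= => /andP[c0 ch].
have cc : 0 <= c <= h by rewrite !ltW.
have hh : 0 <= h <= h by rewrite (ltW h0) lexx.
have zz : (0 : R) <= 0 <= h by rewrite (ltW h0) lexx.
have [_ E1] := rP _ (B c h cc hh); have [_ E2] := rP _ (B c 0 cc zz).
move: E2; rewrite scale0r addr0 => E2.
set d := 'd ('D_v f) x in E1 E2.
have -> : 'D_w ('D_v f) x = d w by rewrite deriveE.
have Ed : d (c *: v + h *: w) = d (c *: v) + h * d w.
  by rewrite linearD; congr (_ + _); exact: linearZ.
have -> : f (x + h *: v + h *: w) - f (x + h *: v) - f (x + h *: w) + f x
      = u h - u 0.
  by rewrite /u !scale0r !addr0 [x + h *: w + h *: v]addrAC; ring.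
rewrite Ec subr0.
rewrite Ed in E1.
have -> : x + h *: w + c *: v = c *: v + h *: w + x.
  by rewrite addrAC -addrA addrC.
rewrite [x + c *: v]addrC.
set p := 'D_v f _ in E1 *; set q := 'D_v f (c *: v + x) in E2 *.
set p0 := 'D_v f x in E1 E2.
have -> : (p - q) * h - h ^+ 2 * d w =
   h * ((p - p0 - (d (c *: v) + h * d w)) - (q - p0 - d (c *: v))) by ring.
rewrite normrM gtr0_norm // expr2 mulrCA ler_pM2l //.
rewrite (le_trans (ler_normB _ _)) // (le_trans (lerD E1 E2)) //.
rewrite -mulrDr -mulrA ler_pM2l // mulrC ler_pdivrMr //.
have := B1 _ _ cc hh; have := B1 c 0 cc zz; rewrite scale0r addr0 => N1 N2.
have N3 : `|c *: v| <= h * `|v| by rewrite normrZ gtr0_norm // ler_wpM2r // ltW.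
by rewrite /C; nra.
Unshelve. all: by end_near. Qed.

(** Schwarz's theorem: the second difference is symmetric in its two
    directions. *)
Lemma derive_comm (R : realType) (V : normedModType R) (f : V -> R) x v w :
  (\forall z \near x, differentiable f z) ->
  differentiable ('D_v f) x -> differentiable ('D_w f) x ->
  'D_w ('D_v f) x = 'D_v ('D_w f) x.
Proof.
move=> df dv dw; apply/eqP; rewrite -subr_eq0 -normr_le0; apply/ler_addgt0Pl => e e0.
have e2 : 0 < e / 2 by rewrite divr_gt0.
have H1 := second_difference w df dv e2; have H2 := second_difference v df dw e2.
have [h [h0 [{}H1 {}H2]]] :=
  filter_ex (filterI (nbhs_right_gt (0 : R)) (filterI H1 H2)).
move: H1 H2; rewrite [x + h *: w + h *: v]addrAC.
move: (f (x + _ + _)) (f (x + h *: w)) (f (x + h *: v)) ('D_w _ x) ('D_v _ x) (f x) h0.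
clear => s p q a b r h0 H1 H2.
have h2 : 0 < h ^+ 2 by rewrite exprn_gt0.
rewrite addr0 -(ler_pM2l h2) -[X in X * `|_|]gtr0_norm // -normrM.
have -> : h ^+ 2 * (a - b) =
  (s - p - q + r - h ^+ 2 * b) - (s - q - p + r - h ^+ 2 * a) by ring.
rewrite (le_trans (ler_normB _ _)) //.
have -> : h ^+ 2 * e = e / 2 * h ^+ 2 + e / 2 * h ^+ 2 by field.
exact: lerD.
Qed.

Lemma derive_comm_rV (R : realType) (V : normedModType R) m (O : set V)
    (f : V -> 'rV[R]_m) x v w : open O -> O x -> Ck 2 O f ->
  'D_w ('D_v f) x = 'D_v ('D_w f) x.
Proof.
move=> oO Ox [df cdf].
have E u z i : O z -> entry i ('D_u f z) = 'D_u (fun z => entry i (f z)) z.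
  move=> Oz; have dfz := df z Oz.
  have dl : differentiable (fun z => entry i (f z)) z.
    exact: (differentiable_lin (@entry_continuous R m i)).
  rewrite (deriveE u dfz) (deriveE u dl); apply: esym.
  exact: (diff_linE u (@entry_continuous R m i)).
have E2 u u' i : entry i ('D_u' ('D_u f) x) = 'D_u' ('D_u (fun z => entry i (f z))) x.
  have [d _] := cdf u; have dx := d x Ox.
  have dl := differentiable_lin (@entry_continuous R m i) dx.
  have H : \forall z \near x, entry i ('D_u f z) = 'D_u (fun z => entry i (f z)) z.
    have nO : \forall z \near x, O z by apply: open_nbhs_nbhs.
    by apply: filterS nO => z; exact: E.
  rewrite -(near_eq_derive _ H) (deriveE u' dx) (deriveE u' dl); apply: esym.
  exact: (diff_linE u' (@entry_continuous R m i)).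
have Cf i : Ck 2 O (fun z => entry i (f z)).
  by apply: (Ck_lin (L := @entry R m i)) => //; exact: entry_continuous.
apply/rowP => i; apply: etrans (E2 v w i) (etrans _ (esym (E2 w v i))).
have [d1 d2] := Cf i.
apply: derive_comm.
- have nO : \forall z \near x, O z by apply: open_nbhs_nbhs.
  by apply: filterS nO => z; exact: d1.
- by have [d _] := d2 v; exact: d.
- by have [d _] := d2 w; exact: d.
Qed.

(** * Poincare's lemma for 1-forms *)

Lemma entry_le_norm (R : realType) m (w : 'rV[R]_m) i : `|entry i w| <= `|w|.
Proof.
rewrite [leRHS]/Num.Def.normr /= mx_normrE.
exact: (le_bigmax _ (fun ij : 'I_1 * 'I_m => `|w ij.1 ij.2|) (0, i)).
Qed.

Lemma diff_entries (R : realType) m (a : 'rV[R]_m -> R) z h :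
  differentiable a z ->
  'd a z h = \sum_i entry i h * 'D_(delta_mx 0 i) a z.
Proof.
move=> da; have E := linear_rV_sum ('d a z) h; apply: etrans E _.
by apply: eq_bigr => i _; rewrite (deriveE (delta_mx 0 i) da).
Qed.

(** By the mean value theorem along the segment, and continuity of the
    partial derivatives at [w]. Uniformity in the base point is what the
    compactness argument for [poincare] needs. *)
Lemma strict_differentiable (R : realType) m (O : set 'rV[R]_m)
    (a : 'rV[R]_m -> R) w (e : R) :
  open O -> O w -> Ck 1 O a -> 0 < e ->
  \forall p \near (w, 0 : 'rV[R]_m),
    `|a (p.1 + p.2) - a p.1 - 'd a (p.1) (p.2)| <= e * `|p.2|.
Proof.
move=> oO Ow [da cda] e0.
(* each of the [m] partial derivatives varies by at most [2 * e'] in the ball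
   found below; [m.+1] avoids a division by zero *)
pose e' := e / (2 * m.+1%:R).
have e'0 : 0 < e' by rewrite divr_gt0 // mulr_gt0.
have nD : \forall z \near w, O z /\ forall i,
    `|'D_(delta_mx 0 i) a w - 'D_(delta_mx 0 i) a z| <= e'.
  near=> z; split.
    by near: z; apply: open_nbhs_nbhs.
  near: z; apply: filter_forall => i.
  by have /cvgrPdist_le := cda (delta_mx 0 i) w Ow; exact.
have [r /= r0 rP] := (nbhs_ballP _ _).1 nD.
have B : \forall p \near (w, 0 : 'rV[R]_m),
    `|w - p.1| < r / 2 /\ `|p.2| < r / 2.
  exists (ball w (r / 2), ball 0 (r / 2)).
    by split; apply: nbhsx_ballx; rewrite divr_gt0.
  by move=> [z h] /= []; rewrite -!ball_normE /= sub0r normrN.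
apply: filterS B => -[z h] /= [zr hr].
have Bz s : 0 <= s <= 1 -> ball w r (z + s *: h).
  move=> /andP[s0 s1]; rewrite -ball_normE /= opprD addrA.
  apply: le_lt_trans (ler_normB _ _) _; rewrite normrZ ger0_norm //.
  have : s * `|h| <= `|h| by rewrite ler_piMl.
  by move: zr hr; lra.
have dz s : 0 <= s <= 1 -> differentiable a (z + s *: h).
  by move=> /Bz /rP[Oz _]; exact: da.
have [c ch Ec] : exists2 c, c \in `]0, 1[%R &
    a (z + 1 *: h) - a (z + 0 *: h) = 'D_h a (z + c *: h) * (1 - 0).
  apply: (MVT (f := fun s => a (z + s *: h)) (df := fun s => 'D_h a (z + s *: h))).
  - exact: ltr01.
  - move=> s; rewrite in_itv /= => /andP[s0 s1].
    by apply: line_derive; apply: dz; rewrite !ltW.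
  - apply: derivable_within_continuous => s; rewrite in_itv /= => sh.
    by have [] := line_derive (dz s sh).
move: Ec; rewrite scale1r scale0r addr0 subr0 mulr1 => ->.
have cc : 0 <= c <= 1 by move: ch; rewrite in_itv /= => /andP[? ?]; rewrite !ltW.
have zz : ((0 : R) <= 0) && ((0 : R) <= (1 : R)) by rewrite lexx ler01.
have := dz 0 zz; rewrite scale0r addr0 => daz.
have -> : 'D_h a (z + c *: h) - 'd a z h = \sum_i entry i h *
    ('D_(delta_mx 0 i) a (z + c *: h) - 'D_(delta_mx 0 i) a z).
  rewrite (deriveE h (dz c cc)).
  apply: etrans (congr2 (fun x y : R => x - y) (diff_entries h (dz c cc))
    (diff_entries h daz)) _.
  by rewrite -sumrB; apply: eq_bigr => i _; rewrite mulrBr.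
apply: le_trans (ler_norm_sum _ _ _) _.
apply: (@le_trans _ _ (\sum_(i < m) `|h| * (2 * e'))).
  apply: ler_sum => i _; rewrite normrM ler_pM //.
    exact: entry_le_norm.
  have [_ /(_ i) H1] := rP _ (Bz c cc).
  have [_ /(_ i) H2] := rP _ (Bz 0 zz).
  rewrite scale0r addr0 in H2.
  rewrite -(subrKA ('D_(delta_mx 0 i) a w)) (le_trans (ler_normD _ _)) //.
  rewrite distrC in H1.
  by rewrite (le_trans (lerD H1 H2)) // mulr2n mulrDl mul1r.
rewrite sumr_const card_ord -[leLHS]mulr_natl /e' [leRHS]mulrC.
have -> : m%:R * (`|h| * (2 * (e / (2 * m.+1%:R))))
    = `|h| * (e * (m%:R / m.+1%:R)) :> R.
  by field; rewrite nat1r pnatr_eq0.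
rewrite ler_wpM2l //.
rewrite ler_piMr ?(ltW e0) // ler_pdivrMr ?ltr0Sn // mul1r ler_nat //.
Unshelve. all: by end_near. Qed.

Lemma primitive01 (R : realType) (g : R -> R) :
  (forall s : R, 0 <= s <= 1 -> {for s, continuous g}) ->
  exists P : R -> R, [/\ P 0 = 0,
    forall s : R, s \in `]0, 1[%R -> is_derive s 1 P (g s) &
    {within `[0, 1], continuous P}].
Proof.
move=> cg.
have ig : (@lebesgue_measure R).-integrable `[0, 1] (EFin \o g).
  apply: continuous_compact_integrable; first exact: segment_compact.
  apply: continuous_in_subspaceT => s; rewrite inE /= in_itv /=; exact: cg.
exists (fun x => parameterized_integral lebesgue_measure 0 x g); split.
- by rewrite /parameterized_integral set_itv1 Rintegral_set1.
- move=> s; rewrite in_itv /= => /andP[s0 s1].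
  have cs : {for s, continuous g} by apply: cg; rewrite !ltW.
  have [D E] := continuous_FTC1_closed s1 ig s0 cs.
  apply: DeriveDef => //; by rewrite -derive1E.
- exact: parameterized_integral_continuous.
Qed.

(** The primitive is the integral [f z] of the form along the radius from
    [x0] to [z]. For fixed [z], the difference [f (z + h) - f z - sum_i h_i
    a_i z] is the increment over [0, 1] of a function of the radial
    parameter whose derivative is small uniformly in that parameter, by
    closedness, [strict_differentiable] and compactness of [0, 1]; the mean
    value theorem concludes without differentiating under the integral. *)
Lemma poincare (R : realType) m (x0 : 'rV[R]_m) (r : R)
    (a : 'I_m -> 'rV[R]_m -> R) :
  (forall i, Ck 1 (ball x0 r) (a i)) ->
  (forall i j z, ball x0 r z ->
     'D_(delta_mx 0 j) (a i) z = 'D_(delta_mx 0 i) (a j) z) ->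
  exists f : 'rV[R]_m -> R, forall z, ball x0 r z ->
    differentiable f z /\ forall v, 'd f z v = \sum_i entry i v * a i z.
Proof.
move=> Ca closed_a.
have oB : open (ball x0 r) by exact: ball_open.
pose pt (z : 'rV[R]_m) (s : R) := x0 + s *: (z - x0).
have ptB z (s : R) : ball x0 r z -> 0 <= s <= 1 -> ball x0 r (pt z s).
  rewrite -ball_normE /= /pt => zr /andP[s0 s1].
  rewrite opprD addrA subrr sub0r normrN normrZ ger0_norm //.
  by apply: le_lt_trans zr; rewrite distrC ler_piMl.
have da i z : ball x0 r z -> differentiable (a i) z by have [+ _] := Ca i; exact.
have ca i z : ball x0 r z -> {for z, continuous (a i)}.
  by move=> Bz; apply: differentiable_continuous; exact: da.
have cpt z (s : R) : {for s, continuous (pt z)}.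
  apply: differentiable_continuous; apply: differentiableD.
    exact: differentiable_cst.
  by apply: ex_diff.
pose g z s := \sum_i entry i (z - x0) * a i (pt z s).
have dE i z (s : R) : ball x0 r z -> 0 <= s <= 1 ->
    is_derive s 1 (fun s => a i (pt z s)) ('D_(z - x0) (a i) (pt z s)).
  by move=> Bz sI; apply: line_derive; apply: da; exact: ptB.
have dg (c : 'I_m -> R) z (s : R) : ball x0 r z -> 0 <= s <= 1 ->
    is_derive s 1 (fun s => \sum_i c i * a i (pt z s))
      (\sum_i c i * 'D_(z - x0) (a i) (pt z s)).
  move=> Bz sI.
  have -> : (fun s => \sum_i c i * a i (pt z s)) = \sum_i (fun s => c i *: a i (pt z s)).
    by apply/funext => t; rewrite fct_sumE.
  apply: is_derive_sum => i; have := dE i z s Bz sI => ?.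
  exact: is_deriveZ.
have cg z (s : R) : ball x0 r z -> 0 <= s <= 1 -> {for s, continuous (g z)}.
  move=> Bz sI; apply: differentiable_continuous; apply/derivable1_diffP.
  by have [] := dg (fun i => entry i (z - x0)) z s Bz sI.
have /choice[P PP] : forall z, exists P : R -> R, ball x0 r z -> [/\ P 0 = 0,
    forall s : R, s \in `]0, 1[%R -> is_derive s 1 P (g z s) &
    {within `[0, 1], continuous P}].
  move=> z; have [Bz|nBz] := pselect (ball x0 r z); last by exists (cst 0).
  by have [Q QP] := primitive01 (fun s sI => cg z s Bz sI); exists Q.
have sym y u h : ball x0 r y ->
    \sum_i entry i h * 'D_u (a i) y = \sum_i entry i u * 'D_h (a i) y.
  move=> By.
  have E k l : \sum_i entry i k * 'D_l (a i) y
      = \sum_i \sum_j entry i k * (entry j l * 'D_(delta_mx 0 j) (a i) y).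
    apply: eq_bigr => i _; rewrite (deriveE l (da i y By)) -mulr_sumr.
    by congr (_ * _); apply: diff_entries; exact: da.
  rewrite !E exchange_big /=; apply: eq_bigr => i _; apply: eq_bigr => j _.
  by rewrite mulrCA closed_a.
exists (fun z => P z 1) => z Bz.
have Llin : linear (fun v : 'rV[R]_m => \sum_i entry i v * a i z : R).
  move=> k u v; rewrite scaler_sumr -big_split; apply: eq_bigr => i _.
  rewrite linearP mulrDl; congr (_ + _); exact: esym (mulrA _ _ _).
pose L : {linear 'rV[R]_m -> R} := HB.pack (fun v : 'rV[R]_m => \sum_i entry i v * a i z : R)
  (GRing.isLinear.Build _ _ _ _ _ Llin).
suff [D E] : differentiable (fun z => P z 1) z /\ 'd (fun z => P z 1) z = L :> (_ -> _).
  by split=> // v; rewrite E.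
apply: eps_differentiable; first exact: linear_rV_continuous.
move=> e e0.
pose u := z - x0.
pose N := m%:R * (`|u| + 1) + 1 : R.
have N0 : 0 < N by rewrite /N ltr_wpDl // mulr_ge0 // addr_ge0.
pose e' := e / N.
have e'0 : 0 < e' by rewrite divr_gt0.
(* Uniformly in [s]: the first order expansion, for the terms with coefficients
   [u], and the mere smallness of the increments, for those with coefficients [h] *)
pose pred (h : 'rV[R]_m) (s : R) := forall i,
  `|a i (pt z s + s *: h) - a i (pt z s) - 'd (a i) (pt z s) (s *: h)|
     <= e' * `|s *: h| /\
  `|a i (pt z s + s *: h) - a i (pt z s)| <= e'.
have cover : \forall h \near (0 : 'rV[R]_m), forall s : R, s \in `[0, 1]%R -> pred h s.
  have /compact_near_coveringP/near_covering_withinP cov := @segment_compact R 0 1.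
  suff /(cov _ (nbhs (0 : 'rV[R]_m)) pred _) : forall s0 : R, `[0, 1]%classic s0 ->
      \forall s' \near s0 & h \near (0 : 'rV[R]_m), `[0, 1]%classic s' -> pred h s'.
    by apply: filterS => h H s; exact: H.
  move=> s0; rewrite /= in_itv /= => s0I.
  have By := ptB z s0 Bz s0I.
  have cvp : (fun p : R * 'rV[R]_m => (pt z p.1, p.1 *: p.2)) @ (s0, 0 : 'rV[R]_m)
      --> (pt z s0, 0 : 'rV[R]_m).
    have c1 : pt z p.1 @[p --> (s0, 0 : 'rV[R]_m)] --> pt z s0.
      apply: continuous_cvg; [exact: cpt|exact: cvg_fst].
    have c2 : p.1 *: p.2 @[p --> (s0, 0 : 'rV[R]_m)] --> (0 : 'rV[R]_m).
      have := @scale_bil_continuous R 'rV[R]_m (s0, 0).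
      by rewrite /continuous_at /= scaler0.
    exact: (cvg_pair c1 c2).
  have F1 i := strict_differentiable oB By (Ca i) e'0.
  have F2 i : \forall p \near (pt z s0, 0 : 'rV[R]_m),
      `|a i (p.1 + p.2) - a i p.1| <= e'.
    have /cvgrPdist_le/(_ e' e'0) : (fun p : 'rV[R]_m * 'rV[R]_m =>
        a i (p.1 + p.2) - a i p.1) @ (pt z s0, 0 : 'rV[R]_m)
        --> a i (pt z s0) - a i (pt z s0).
      have c1 : a i p.1 @[p --> (pt z s0, 0 : 'rV[R]_m)] --> a i (pt z s0).
        apply: continuous_cvg; [exact: ca|exact: cvg_fst].
      have c2 : p.1 + p.2 @[p --> (pt z s0, 0 : 'rV[R]_m)] --> pt z s0.
        by rewrite -[X in _ --> X]addr0; apply: cvgD; [exact: cvg_fst|exact: cvg_snd].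
      exact: (cvgB (cvg_comp _ _ c2 (ca i _ By)) c1).
    by apply: filterS => p; rewrite subrr sub0r normrN.
  have K i : \forall p \near (s0, 0 : 'rV[R]_m),
     `|a i (pt z p.1 + p.1 *: p.2) - a i (pt z p.1)
        - 'd (a i) (pt z p.1) (p.1 *: p.2)| <= e' * `|p.1 *: p.2| /\
     `|a i (pt z p.1 + p.1 *: p.2) - a i (pt z p.1)| <= e'.
    exact: cvp (filterI (F1 i) (F2 i)).
  have := @filter_forall _ _ _ _ (nbhs_filter (s0, 0 : 'rV[R]_m)) K.
  by apply: filterS => -[s h] /= H _.
have nB : \forall h \near (0 : 'rV[R]_m), ball x0 r (h + z).
  have : \forall y \near z, ball x0 r y by apply: open_nbhs_nbhs.
  by rewrite (near_shift 0 z); apply: filterS => k; rewrite /= subr0.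
near=> h.
have Bzh : ball x0 r (h + z) by near: h.
have ptE s : pt (h + z) s = pt z s + s *: h.
  by rewrite /pt -[h + z - x0]addrA scalerDr [s *: h + _]addrC addrA.
have [P0 dP cP] := PP z Bz; have [P0' dP' cP'] := PP _ Bzh.
pose A (s : R) := \sum_i entry i h * a i (pt z s).
(* the error to be bounded is the increment of [Q] over [0, 1] *)
pose Q := (P (h + z) \- P z) \- (id \* A).
have dA (s : R) : 0 <= s <= 1 -> is_derive s 1 (id \* A)
    (s * (\sum_i entry i h * 'D_u (a i) (pt z s)) + A s).
  move=> sI; have := dg (fun i => entry i h) z s Bz sI => dAs.
  have := is_deriveM (is_derive_id s (1 : R)) dAs.
  by rewrite /GRing.scale /= mulr1.
pose q (s : R) := (g (h + z) s - g z s)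
   - (s * (\sum_i entry i h * 'D_u (a i) (pt z s)) + A s).
have [c cI Ec] : exists2 c, c \in `]0, 1[%R & Q 1 - Q 0 = q c * (1 - 0).
  apply: MVT; first exact: ltr01.
    move=> s sI; have := dP s sI; have := dP' s sI => d1 d2.
    have sI' : 0 <= s <= 1 by move: sI; rewrite in_itv /= => /andP[? ?]; rewrite !ltW.
    by have := dA s sI' => d3; apply: is_deriveB.
  move=> s; apply: continuousB; first by apply: continuousB; [exact: cP'|exact: cP].
  apply: (derivable_within_continuous (f := id \* A)) => t.
  by rewrite in_itv /= => tI; have [] := dA t tI.
have cI' : 0 <= c <= 1 by move: cI; rewrite in_itv /= => /andP[? ?]; rewrite !ltW.
have -> : P (h + z) 1 - P z 1 - L h = q c.
  rewrite subr0 mulr1 in Ec; rewrite -Ec /Q /= P0 P0' mul0r !subr0 mul1r.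
  by congr (_ - _); apply: eq_bigr => i _; rewrite /pt scale1r addrC subrK.
pose b i := a i (pt z c + c *: h) - a i (pt z c).
(* by [sym], that is, by closedness, each increment [b i] meets its first order term *)
have -> : q c = \sum_i (entry i u * (b i - 'd (a i) (pt z c) (c *: h))
    + entry i h * b i).
  rewrite /q sym; last exact: ptB.
  rewrite /g /A mulr_sumr -sumrB -big_split -sumrB; apply: eq_bigr => i _ /=.
  rewrite (deriveE h (da i _ (ptB z c Bz cI'))) ptE -addrA linearD.
  have -> : 'd (a i) (pt z c) (c *: h) = c * 'd (a i) (pt z c) h by exact: linearZ.
  by rewrite /b /u; ring.
have cov : forall i, `|b i - 'd (a i) (pt z c) (c *: h)| <= e' * `|h| /\ `|b i| <= e'.
  have coverh : forall s : R, s \in `[0, 1]%R -> pred h s by near: h.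
  have := coverh c; rewrite in_itv /= => /(_ cI') H i.
  have [H1 H2] := H i; split=> //; apply: le_trans H1 _.
  move/andP: cI' => [c0 c1]; rewrite normrZ (ger0_norm c0) ler_pM2l //.
  by rewrite ler_piMl.
apply: le_trans (ler_norm_sum _ _ _) _.
apply: (@le_trans _ _ (\sum_(i < m) (`|u| * (e' * `|h|) + `|h| * e'))).
  apply: ler_sum => i _; have [H1 H2] := cov i.
  rewrite (le_trans (ler_normD _ _)) // !normrM.
  by apply: lerD; apply: ler_pM => //; exact: entry_le_norm.
rewrite sumr_const card_ord -[leLHS]mulr_natl.
have -> : m%:R * (`|u| * (e' * `|h|) + `|h| * e')
    = e * `|h| * ((m%:R * (`|u| + 1)) / N).
  by rewrite /e'; field; rewrite gt_eqF.
by rewrite ler_piMr ?mulr_ge0 ?(ltW e0) // ler_pdivrMr // mul1r /N lerDl.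
Unshelve. all: by end_near. Qed.

(** * The Minkowski product *)

Lemma mink_is_bilinear (R : realType) (n : nat) :
  bilinear_for
    (GRing.Scale.Law.clone _ _ *:%R _) (GRing.Scale.Law.clone _ _ *:%R _)
    (@mink R n : 'rV[R]_n.+2 -> 'rV[R]_n.+2 -> R).
Proof.
split=> [z|z] a x y; rewrite /mink /= scalerBr addrACA -opprD scaler_sumr -big_split /=.
- congr (_ - _); first apply: eq_bigr => i _; rewrite !mxE mulrDl;
    by congr (_ + _); exact: esym (mulrA _ _ _).
- congr (_ - _); first apply: eq_bigr => i _; rewrite !mxE mulrDr;
    by congr (_ + _); exact: mulrCA.
Qed.

HB.instance Definition _ (R : realType) (n : nat) :=
  bilinear_isBilinear.Build R 'rV[R]_n.+2 'rV[R]_n.+2 R _ _ (@mink R n)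
    (@mink_is_bilinear R n).

Lemma minkC (R : realType) (n : nat) (x y : 'rV[R]_n.+2) : mink x y = mink y x.
Proof.
by rewrite /mink mulrC; congr (_ - _); apply: eq_bigr => i _; rewrite mulrC.
Qed.

Lemma minkDl (R : realType) (n : nat) (x y z : 'rV[R]_n.+2) :
  mink (x + y) z = mink x z + mink y z.
Proof. exact: linearDl. Qed.

Lemma minkZl (R : realType) (n : nat) a (x z : 'rV[R]_n.+2) :
  mink (a *: x) z = a * mink x z.
Proof. exact: linearZl_LR. Qed.

Lemma minkDr (R : realType) (n : nat) (x y z : 'rV[R]_n.+2) :
  mink z (x + y) = mink z x + mink z y.
Proof. by rewrite minkC minkDl !(minkC z). Qed.

Lemma minkZr (R : realType) (n : nat) a (x z : 'rV[R]_n.+2) :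
  mink z (a *: x) = a * mink z x.
Proof. by rewrite minkC minkZl (minkC z). Qed.

Lemma minkNl (R : realType) (n : nat) (x z : 'rV[R]_n.+2) :
  mink (- x) z = - mink x z.
Proof. by rewrite -scaleN1r minkZl mulN1r. Qed.

Lemma minkNr (R : realType) (n : nat) (x z : 'rV[R]_n.+2) :
  mink z (- x) = - mink z x.
Proof. by rewrite minkC minkNl minkC. Qed.

Lemma mink0l (R : realType) (n : nat) (z : 'rV[R]_n.+2) : mink 0 z = 0.
Proof. exact: linear0l. Qed.

Lemma mink0r (R : realType) (n : nat) (z : 'rV[R]_n.+2) : mink z 0 = 0.
Proof. by rewrite minkC mink0l. Qed.

Definition minkE := (minkDl, minkDr, minkZl, minkZr, minkNl, minkNr, mink0l, mink0r).

Lemma mink_continuous (R : realType) (n : nat) :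
  continuous (fun p : 'rV[R]_n.+2 * 'rV[R]_n.+2 => mink p.1 p.2).
Proof.
have H i : Ck 0 setT (fun p : 'rV[R]_n.+2 * 'rV[R]_n.+2 =>
    (if i == ord_max then -1 else 1) *: (entry i p.1 * entry i p.2) : R).
  have C1 : Ck 0 setT (fun p : 'rV[R]_n.+2 * 'rV[R]_n.+2 => entry i p.1).
    by move=> p _; apply: (@continuous_cvg _ _ _ _ _ fst (@entry R _ i));
      [exact: entry_continuous|exact: cvg_fst].
  have C2 : Ck 0 setT (fun p : 'rV[R]_n.+2 * 'rV[R]_n.+2 => entry i p.2).
    by move=> p _; apply: (@continuous_cvg _ _ _ _ _ snd (@entry R _ i));
      [exact: entry_continuous|exact: cvg_snd].
  have sc := @scale_bil_continuous R R.
  exact: (Ck_bil (B := @GRing.scale R R) openT sc (Ck_cst _ _ _)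
    (Ck_bil (B := @GRing.scale R R) openT sc C1 C2)).
have {}H := Ck_sum (index_enum 'I_n.+2) openT H.
move=> p; have := H p I.
have -> // : (fun z : 'rV[R]_n.+2 * 'rV[R]_n.+2 =>
   \sum_i (if i == ord_max then -1 else 1) *: (entry i z.1 * entry i z.2) : R)
   = (fun p => mink p.1 p.2).
apply/funext => z; rewrite (bigD1 ord_max) //= eqxx scaleN1r addrC; congr (_ + _).
by apply: eq_bigr => i /negbTE ->; rewrite scale1r.
Qed.

Lemma diff_minkE (R : realType) (n : nat) (U : normedModType R)
    (f g : U -> 'rV[R]_n.+2) x v : differentiable f x -> differentiable g x ->
  differentiable (fun z => mink (f z) (g z)) x /\
  'd (fun z => mink (f z) (g z)) x v = mink ('d f x v) (g x) + mink (f x) ('d g x v).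
Proof.
move=> df dg; have c := @mink_continuous R n.
by split; [exact: (differentiable_bil (B := @mink R n))|exact: (diff_bilE (B := @mink R n))].
Qed.

Lemma diff_mink_const (R : realType) (n : nat) (U : normedModType R)
    (f g : U -> 'rV[R]_n.+2) x (c : R) v : differentiable f x -> differentiable g x ->
  (\forall z \near x, c = mink (f z) (g z)) ->
  mink ('d f x v) (g x) + mink (f x) ('d g x v) = 0.
Proof.
move=> df dg H; have [_ E] := diff_minkE v df dg.
have [_ E'] := near_differentiable H (differentiable_cst c x).
by apply: etrans (esym E) (etrans (congr1 (@^~ v) E') _); exact: diff_cstE.
Qed.

Lemma smooth_mink (R : realType) (n : nat) (U : normedModType R) (O : set U)
    (f g : U -> 'rV[R]_n.+2) : open O -> smooth_on O f -> smooth_on O g ->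
  smooth_on O (fun z => mink (f z) (g z)).
Proof.
move=> oO sk sf j; apply: (Ck_bil (B := @mink R n)) => //.
exact: mink_continuous.
Qed.

(** A form of Lagrange's identity, which makes the product positive definite
    on the orthogonal of the timelike vector [x]. *)
Lemma mink_perp_sum (R : realType) (n : nat) (x w : 'rV[R]_n.+2) :
  mink x x = -1 -> mink w x = 0 ->
  x 0 ord_max ^+ 2 * mink w w =
  \sum_(i < n.+2 | i != ord_max) (w 0 i * x 0 ord_max - x 0 i * w 0 ord_max) ^+ 2
   + w 0 ord_max ^+ 2.
Proof.
rewrite /mink; set p := x 0 ord_max; set q := w 0 ord_max.
set X := \sum_(_ | _) x _ _ * _; set W := \sum_(_ | _) w _ _ * x _ _ => EX EW.
have -> : \sum_(i < n.+2 | i != ord_max) (w 0 i * p - x 0 i * q) ^+ 2 =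
   p ^+ 2 * (\sum_(i < n.+2 | i != ord_max) w 0 i * w 0 i)
   - 2 * p * q * W + q ^+ 2 * X.
  rewrite /X /W !mulr_sumr -sumrB -big_split; apply: eq_bigr => i _ /=; ring.
have -> : X = p * p - 1 by rewrite -EX subrKC; lra.
have -> : W = q * p by apply/eqP; rewrite -subr_eq0 EW.
by ring.
Qed.

Lemma timelike_last_neq0 (R : realType) (n : nat) (x : 'rV[R]_n.+2) :
  mink x x = -1 -> 0 < x 0 ord_max ^+ 2.
Proof.
rewrite /mink => E.
have : 0 <= \sum_(i < n.+2 | i != ord_max) x 0 i * x 0 i.
  by apply: sumr_ge0 => i _; rewrite -expr2 sqr_ge0.
by rewrite expr2; lra.
Qed.

Lemma mink_perp_eq0 (R : realType) (n : nat) (x w : 'rV[R]_n.+2) :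
  mink x x = -1 -> mink w x = 0 -> mink w w = 0 -> w = 0.
Proof.
move=> Ex Ew Eww; have := mink_perp_sum Ex Ew; rewrite Eww mulr0 => /esym /eqP.
have S0 i : i != ord_max ->
    0 <= (w 0 i * x 0 ord_max - x 0 i * w 0 ord_max) ^+ 2 by rewrite sqr_ge0.
rewrite paddr_eq0 ?sqr_ge0 ?sumr_ge0 // psumr_eq0 // => /andP[/allP H].
rewrite sqrf_eq0 => /eqP w0.
apply/rowP => i; rewrite mxE; have [->//|im] := eqVneq i ord_max.
have := H i (mem_index_enum i); rewrite im w0 mulr0 subr0 sqrf_eq0 mulf_eq0.
case/orP => [/eqP //|/eqP x0].
by have := timelike_last_neq0 Ex; rewrite x0 expr0n /= ltxx.
Qed.

(** * The geodesic flow *)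

Lemma cosh_sq (R : realType) (t : R) : cosh t ^+ 2 - sinh t ^+ 2 = 1.
Proof.
have := expRxMexpNx_1 t; rewrite /cosh /sinh; move: (expR t) (expR (- t)) => a b E.
have -> : ((a + b) / 2) ^+ 2 - ((a - b) / 2) ^+ 2 = a * b by field.
by [].
Qed.

Lemma coshD (R : realType) (s t : R) :
  cosh (s + t) = cosh s * cosh t + sinh s * sinh t.
Proof. by rewrite /cosh /sinh opprD !expRD; field. Qed.

Lemma sinhD (R : realType) (s t : R) :
  sinh (s + t) = sinh s * cosh t + cosh s * sinh t.
Proof. by rewrite /cosh /sinh opprD !expRD; field. Qed.

Lemma cosh0 (R : realType) : cosh (0 : R) = 1.
Proof. by rewrite /cosh oppr0 expR0; field. Qed.

Lemma sinh0 (R : realType) : sinh (0 : R) = 0.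
Proof. by rewrite /sinh oppr0 expR0; field. Qed.

Lemma coshN (R : realType) (t : R) : cosh (- t) = cosh t.
Proof. by rewrite /cosh opprK addrC. Qed.

Lemma sinhN (R : realType) (t : R) : sinh (- t) = - sinh t.
Proof. by rewrite /sinh opprK -mulNr opprB. Qed.

Lemma sinh_eq0 (R : realType) (t : R) : sinh t = 0 -> t = 0.
Proof.
move/eqP; rewrite /sinh mulf_eq0 invr_eq0 pnatr_eq0 orbF subr_eq0 => /eqP.
by move/expR_inj; lra.
Qed.

Lemma sinh_lt_cosh (R : realType) (t : R) : `|sinh t| < cosh t.
Proof.
rewrite ltr_norml /sinh /cosh; have := expR_gt0 t; have := expR_gt0 (- t).
by move=> *; apply/andP; split; lra.
Qed.

Lemma is_derive_expRN (R : realType) (t : R) :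
  is_derive t 1 (expR \o -%R) (- expR (- t)).
Proof.
have d1 : is_derive t 1 (-%R : R -> R) (- 1) by exact: is_deriveNid.
by have := is_derive1_comp (is_derive_expR (- t)) d1; rewrite mulrN1.
Qed.

Lemma is_derive_cosh (R : realType) (t : R) : is_derive t 1 (@cosh R) (sinh t).
Proof.
have dn := is_derive_expRN t.
have -> : @cosh R = 2^-1 *: (@expR R + (expR \o -%R)).
  by apply/funext => s; exact: (mulrC (expR s + expR (- s)) 2^-1).
by apply: is_derive_eq; exact: (mulrC 2^-1 (expR t - expR (- t))).
Qed.

Lemma is_derive_sinh (R : realType) (t : R) : is_derive t 1 (@sinh R) (cosh t).
Proof.
have dn := is_derive_expRN t.
have -> : @sinh R = 2^-1 *: (@expR R - (expR \o -%R)).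
  by apply/funext => s; exact: (mulrC (expR s - expR (- s)) 2^-1).
by apply: is_derive_eq; rewrite opprK; exact: (mulrC 2^-1 (expR t + expR (- t))).
Qed.

Lemma diff_cosh (R : realType) (V : normedModType R) (f : V -> R) x v :
  differentiable f x ->
  differentiable (fun z => cosh (f z)) x /\
  'd (fun z => cosh (f z)) x v = sinh (f x) * 'd f x v.
Proof.
move=> df; have d := is_derive_cosh (f x).
have dc : differentiable (@cosh R) (f x) by apply/derivable1_diffP; case: d.
split; first exact: (differentiable_comp df dc).
rewrite (diff_compE v df dc) deriv1E; last by case: d.
by rewrite derive1E derive_val; exact: mulrC.
Qed.

Lemma diff_sinh (R : realType) (V : normedModType R) (f : V -> R) x v :
  differentiable f x ->
  differentiable (fun z => sinh (f z)) x /\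
  'd (fun z => sinh (f z)) x v = cosh (f x) * 'd f x v.
Proof.
move=> df; have d := is_derive_sinh (f x).
have dc : differentiable (@sinh R) (f x) by apply/derivable1_diffP; case: d.
split; first exact: (differentiable_comp df dc).
rewrite (diff_compE v df dc) deriv1E; last by case: d.
by rewrite derive1E derive_val; exact: mulrC.
Qed.

Lemma smooth_cosh_sinh (R : realType) (U : normedModType R) (O : set U) (f : U -> R) :
  open O -> smooth_on O f ->
  smooth_on O (fun z => cosh (f z)) /\ smooth_on O (fun z => sinh (f z)).
Proof.
move=> oO sf.
have s1 : smooth_on O (fun z => expR (f z)) by move=> k; exact: Ck_expR oO (sf k).
have s2 : smooth_on O (fun z => expR (- f z)).
  by move=> k; exact: Ck_expR oO (smooth_opp oO sf k).
have h := fun j => Ck_cst j O (2^-1 : R).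
split=> k.
  have := smooth_scale oO h (smooth_add oO s1 s2) k.
  by apply: Ck_ext => // x _; exact: (mulrC 2^-1 (expR (f x) + expR (- f x))).
have := smooth_scale oO h (smooth_add oO s1 (smooth_opp oO s2)) k.
by apply: Ck_ext => // x _; exact: (mulrC 2^-1 (expR (f x) - expR (- f x))).
Qed.

Lemma flow0 (R : realType) (n : nat) (y : 'rV[R]_n.+2 * 'rV[R]_n.+2) :
  geodesic_flow 0 y = y.
Proof.
by rewrite /geodesic_flow cosh0 sinh0 !scale1r !scale0r addr0 add0r; case: y.
Qed.

Lemma flowD (R : realType) (n : nat) s t (y : 'rV[R]_n.+2 * 'rV[R]_n.+2) :
  geodesic_flow s (geodesic_flow t y) = geodesic_flow (s + t) y.
Proof.
rewrite /geodesic_flow /= coshD sinhD !scalerDr !scalerA !scalerDl.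
by congr (_, _); rewrite addrACA; congr (_ + _); rewrite addrC.
Qed.

Lemma mem_proj (R : realType) (n : nat) (y : 'rV[R]_n.+2 * 'rV[R]_n.+2) :
  proj y y.
Proof. by exists 0; rewrite flow0. Qed.

Lemma proj_flow (R : realType) (n : nat) t (y : 'rV[R]_n.+2 * 'rV[R]_n.+2) :
  proj (geodesic_flow t y) = proj y.
Proof.
apply/seteqP; split=> z [s ->]; first by exists (s + t); rewrite flowD.
by exists (s - t); rewrite flowD subrK.
Qed.

Lemma proj_eq_flow (R : realType) (n : nat) (y z : 'rV[R]_n.+2 * 'rV[R]_n.+2) :
  proj z = proj y -> exists t, z = geodesic_flow t y.
Proof. by move=> E; have := mem_proj z; rewrite E. Qed.

(** The time component of the velocity is dominated by that of the base
    point, by [mink_perp_sum]; as [sinh] is smaller than [cosh], the flow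
    stays in the upper sheet. *)
Lemma unit_tangent_last_le (R : realType) (n : nat) (y : 'rV[R]_n.+2 * 'rV[R]_n.+2) :
  unit_tangent y -> `|y.2 0 ord_max| <= y.1 0 ord_max.
Proof.
move=> [[Exx x0] Exv Evv].
have := mink_perp_sum Exx (etrans (minkC _ _) Exv); rewrite Evv mulr1 => E.
rewrite -ler_sqr ?nnegrE ?(ltW x0) // real_normK ?num_real // E lerDr.
by apply: sumr_ge0 => i _; exact: sqr_ge0.
Qed.

Lemma unit_tangent_flow (R : realType) (n : nat) t (y : 'rV[R]_n.+2 * 'rV[R]_n.+2) :
  unit_tangent y -> unit_tangent (geodesic_flow t y).
Proof.
move=> U; have [[Exx x0] Exv Evv] := U; have L := unit_tangent_last_le U.
have Evx := etrans (minkC _ _) Exv; have C := cosh_sq t.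
split; [split|..]; rewrite /= ?minkE ?Exx ?Exv ?Evv ?Evx.
- by rewrite mulr0 mulr1 !addr0 mulrN1; move: C; lra.
- rewrite !mxE; have S := sinh_lt_cosh t.
  have : - (`|sinh t| * `|y.2 0 ord_max|) <= sinh t * y.2 0 ord_max.
    by rewrite -normrM lerNnormlW.
  have : `|sinh t| * `|y.2 0 ord_max| <= `|sinh t| * y.1 0 ord_max by rewrite ler_wpM2l.
  have : `|sinh t| * y.1 0 ord_max < cosh t * y.1 0 ord_max by rewrite ltr_pM2r.
  by lra.
- by ring.
- by move: C; lra.
Qed.

(** The time needed to move along a geodesic is read off Minkowski products,
    hence depends smoothly on the end points. *)
Lemma flow_coord (R : realType) (n : nat) t (y : 'rV[R]_n.+2 * 'rV[R]_n.+2) :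
  unit_tangent y ->
  cosh t = - mink (geodesic_flow t y).1 y.1 /\
  sinh t = mink (geodesic_flow t y).1 y.2.
Proof.
move=> [[Exx _] Exv Evv]; have Evx := etrans (minkC _ _) Exv.
rewrite /= !minkE Exx Exv Evv Evx; split; ring.
Qed.

Lemma flow_linear (R : realType) (n : nat) (t : R) :
  linear (@geodesic_flow R n t :
    ('rV[R]_n.+2 * 'rV[R]_n.+2)%type -> ('rV[R]_n.+2 * 'rV[R]_n.+2)%type).
Proof.
move=> k [a b] [c d]; congr (_, _) => /=;
  rewrite !scalerDr !scalerA addrACA; congr (_ + _ + (_ + _)); congr (_ *: _);
  exact: mulrC.
Qed.

HB.instance Definition _ (R : realType) (n : nat) (t : R) :=
  GRing.isLinear.Build R ('rV[R]_n.+2 * 'rV[R]_n.+2)%type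
    ('rV[R]_n.+2 * 'rV[R]_n.+2)%type _ (@geodesic_flow R n t) (@flow_linear R n t).

Lemma flow_continuous (R : realType) (n : nat) (t : R) :
  continuous (@geodesic_flow R n t).
Proof.
move=> y; apply: differentiable_continuous.
have dy : differentiable (@id ('rV[R]_n.+2 * 'rV[R]_n.+2)%type) y by exact: ex_diff.
have d1 := differentiable_fst dy; have d2 := differentiable_snd dy.
by apply: differentiable_pair; apply: differentiableD; apply: differentiableZ.
Qed.

Lemma diff_flow0 (R : realType) (n : nat) (y : 'rV[R]_n.+2 * 'rV[R]_n.+2) :
  differentiable (fun t : R => geodesic_flow t y) 0 /\
  'd (fun t : R => geodesic_flow t y) 0 1 = (y.2, y.1).
Proof.
have did : differentiable (@id R) 0 by exact: ex_diff.
have Eid : 'd (@id R) 0 1 = 1 by rewrite diff_val.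
have [dc Ec] := diff_cosh (1 : R) did; have [ds Es] := diff_sinh (1 : R) did.
rewrite Eid sinh0 mul0r in Ec; rewrite Eid cosh0 mul1r in Es.
have [d1 E1] := diff_scale_comb y.1 y.2 (1 : R) dc ds.
have [d2 E2] := diff_scale_comb y.1 y.2 (1 : R) ds dc.
split; first exact: (differentiable_pair d1 d2).
apply: etrans (diff_pairE _ d1 d2) _; congr (_, _).
  by apply: etrans E1 _; rewrite Ec Es scale0r scale1r add0r.
by apply: etrans E2 _; rewrite Ec Es scale0r scale1r addr0.
Qed.

(** Up to sign, the differential of the Liouville form [xi |-> mink y.2
    xi.1]. *)
Definition omega (R : realType) (n : nat) (xi eta : 'rV[R]_n.+2 * 'rV[R]_n.+2) : R :=
  mink xi.1 eta.2 - mink xi.2 eta.1.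

Lemma omega_flow (R : realType) (n : nat) t (xi eta : 'rV[R]_n.+2 * 'rV[R]_n.+2) :
  omega (geodesic_flow t xi) (geodesic_flow t eta) = omega xi eta.
Proof.
rewrite /omega /= !minkE.
have -> : mink xi.1 eta.2 - mink xi.2 eta.1 =
  (cosh t ^+ 2 - sinh t ^+ 2) * (mink xi.1 eta.2 - mink xi.2 eta.1).
  by rewrite cosh_sq mul1r.
by ring.
Qed.

Lemma omega_pair (R : realType) (n : nat) (U : normedModType R)
    (S N : U -> 'rV[R]_n.+2) z X Y : differentiable S z -> differentiable N z ->
  omega ('d (fun z => (S z, N z)) z X) ('d (fun z => (S z, N z)) z Y) =
  mink ('d S z X) ('d N z Y) - mink ('d N z X) ('d S z Y).
Proof.
move=> dS dN; have := diff_pairE X dS dN; have := diff_pairE Y dS dN.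
move: ('d (fun z => (S z, N z)) z X) ('d (fun z => (S z, N z)) z Y).
by move=> x y -> ->.
Qed.

(** * Tangent vectors of the unit tangent bundle *)

(** Valid for either sign of [q], so that it serves for curves in the
    hyperbolic space as well as in the unit sphere of a tangent space. *)
Lemma conic_param (R : realType) (q : R) : exists a b : R -> R,
  [/\ differentiable a 0, differentiable b 0, a 0 = 1 & b 0 = 0] /\
  [/\ 'd a 0 1 = 0, 'd b 0 1 = 1 &
      \forall r \near 0, a r ^+ 2 - q * b r ^+ 2 = 1].
Proof.
pose c := q / 4; pose D (r : R) := 1 - c * r ^+ 2.
have D0 : D 0 = 1 by rewrite /D expr0n mulr0 subr0.
have dsq : is_derive (0 : R) 1 (fun r : R => c * r ^+ 2) 0.
  have -> : (fun r : R => c * r ^+ 2) = c *: (@id R ^+ 2) by [].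
  by apply: is_derive_eq; rewrite /= expr1 mulr0 scale0r scaler0.
have dD : is_derive (0 : R) 1 D 0.
  have -> : D = cst 1 - (fun r : R => c * r ^+ 2) by [].
  by apply: is_derive_eq; rewrite subr0.
have dN : is_derive (0 : R) 1 (fun r : R => 1 + c * r ^+ 2) 0.
  have -> : (fun r : R => 1 + c * r ^+ 2) = cst 1 + (fun r : R => c * r ^+ 2) by [].
  by apply: is_derive_eq; rewrite addr0.
have dV : is_derive (0 : R) 1 (fun r => (D r)^-1) 0.
  apply: DeriveDef; first by apply: derivableV; rewrite ?D0 ?oner_neq0.
  by rewrite deriveV ?D0 ?oner_neq0 // derive_val scaler0.
exists (fun r : R => (1 + c * r ^+ 2) * (D r)^-1), (fun r : R => r * (D r)^-1).
have da := is_deriveM dN dV; have db := is_deriveM (is_derive_id (0 : R) (1 : R)) dV.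
have diffa : differentiable (fun r : R => (1 + c * r ^+ 2) * (D r)^-1) 0.
  by apply/derivable1_diffP; case: da.
have diffb : differentiable (fun r : R => r * (D r)^-1) 0.
  by apply/derivable1_diffP; case: db.
split; split=> //.
- by rewrite D0 invr1 mulr1 expr0n /= mulr0 addr0.
- by rewrite mul0r.
- rewrite -(deriveE _ diffa); case: da => _ ->; by rewrite !scaler0 addr0.
- rewrite -(deriveE _ diffb); case: db => _ ->.
  by rewrite D0 scaler0 add0r invr1 scale1r.
- have cD : {for (0 : R), continuous D}.
    by apply: differentiable_continuous; apply/derivable1_diffP; case: dD.
  have : \forall r \near (0 : R), D r != 0.
    by apply: (cvgr_neq0 _ cD); rewrite D0 oner_neq0.
  apply: filterS => r Dr.
  have -> : q = 4 * c by rewrite /c; field.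
  by rewrite /D in Dr *; field.
Qed.

Lemma curve_vanish (R : realType) (V W : normedModType R) (Phi : V -> W)
    (c : R -> V) y :
  differentiable Phi y -> differentiable c 0 -> c 0 = y ->
  (\forall r \near 0, Phi (c r) = 0) -> 'd Phi y ('d c 0 1) = 0.
Proof.
move=> dP dc c0 H; rewrite -c0 in dP *; rewrite -(diff_compE (1 : R) dc dP).
have Hn : \forall r \near (0 : R), cst 0 r = (Phi \o c) r by apply: filterS H => r /= ->.
have [_ ->] := near_differentiable Hn (differentiable_cst 0 (0 : R)).
by rewrite diff_cst.
Qed.

(** By linearity it is enough to treat horizontal and vertical vectors,
    where only one of the base point and of the velocity moves; it does so
    along a conic in the unit tangent bundle, on which [Phi] vanishes. *)
Lemma vanish_tangent (R : realType) (n : nat) (W : normedModType R)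
    (Phi : 'rV[R]_n.+2 * 'rV[R]_n.+2 -> W) y xi :
  unit_tangent y -> differentiable Phi y ->
  (\forall z \near y, unit_tangent z -> Phi z = 0) ->
  chi_orth y xi -> 'd Phi y xi = 0.
Proof.
case: y xi => x v [w u] [[/= Exx x0] /= Exv Evv] dP H [/= wx wv ux uv].
have Evx := etrans (minkC _ _) Exv.
have xw := etrans (minkC _ _) wx; have vw := etrans (minkC _ _) wv.
have xu := etrans (minkC _ _) ux; have vu := etrans (minkC _ _) uv.
have hor : 'd Phi (x, v) (w, 0) = 0.
  have [a [b [[da db a0 b0] [a1 b1 Hab]]]] := conic_param (mink w w).
  have [dc dcE] := diff_scale_comb x w (1 : R) da db.
  have dv := differentiable_cst v (0 : R).
  have E : 'd (fun r => (a r *: x + b r *: w, cst v r)) 0 1 = (w, 0).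
    apply: etrans (diff_pairE _ dc dv) _; congr (_, _); last exact: diff_cstE.
    by apply: etrans dcE _; rewrite a1 b1 scale0r add0r scale1r.
  have dp := differentiable_pair dc dv.
  rewrite -E; apply: curve_vanish => //; first by rewrite a0 b0 scale1r scale0r addr0.
  have cp := differentiable_continuous dp.
  have Hx : \forall r \near 0, 0 < (a r *: x + b r *: w) 0 ord_max.
    have dl := differentiable_lin (@entry_continuous R _ ord_max) dc.
    apply: (cvgr_gt _ (differentiable_continuous dl)).
    by rewrite a0 b0 scale1r scale0r addr0.
  have {}H : \forall r \near 0, unit_tangent (a r *: x + b r *: w, v) ->
     Phi (a r *: x + b r *: w, v) = 0.
    have Ep : (x, v) = (a 0 *: x + b 0 *: w, v) by rewrite a0 b0 scale1r scale0r addr0.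
    by move: H; rewrite Ep; exact: cp.
  near=> r; have /= Hr := near H r; apply: Hr => //.
  split; [split|..] => //=; last by rewrite !minkE Exv wv !mulr0 addr0.
    have E1 : a r ^+ 2 - mink w w * b r ^+ 2 = 1 by near: r.
    rewrite !minkE Exx wx xw.
    by apply: etrans (congr1 -%R E1); ring.
  by near: r.
have ver : 'd Phi (x, v) (0, u) = 0.
  have [a [b [[da db a0 b0] [a1 b1 Hab]]]] := conic_param (- mink u u).
  have [dc dcE] := diff_scale_comb v u (1 : R) da db.
  have dx := differentiable_cst x (0 : R).
  have E : 'd (fun r => (cst x r, a r *: v + b r *: u)) 0 1 = (0, u).
    apply: etrans (diff_pairE _ dx dc) _; congr (_, _); first exact: diff_cstE.
    by apply: etrans dcE _; rewrite a1 b1 scale0r add0r scale1r.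
  have dp := differentiable_pair dx dc.
  rewrite -E; apply: curve_vanish => //; first by rewrite a0 b0 scale1r scale0r addr0.
  have cp := differentiable_continuous dp.
  have {}H : \forall r \near 0, unit_tangent (x, a r *: v + b r *: u) ->
     Phi (x, a r *: v + b r *: u) = 0.
    have Ep : (x, v) = (x, a 0 *: v + b 0 *: u) by rewrite a0 b0 scale1r scale0r addr0.
    by move: H; rewrite Ep; exact: cp.
  near=> r; have /= Hr := near H r; apply: Hr => //.
  have E1 : a r ^+ 2 - - mink u u * b r ^+ 2 = 1 by near: r.
  split => //=; first by rewrite !minkE Exv xu !mulr0 addr0.
  rewrite !minkE Evv uv vu.
  by apply: etrans E1; ring.
have -> : (w, u) = (w, 0) + (0, u) by rewrite /GRing.add /= /add_pair /= addr0 add0r.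
by rewrite linearD hor ver addr0.
Unshelve. all: by end_near. Qed.

Lemma tangent_unit_tangent (R : realType) (n : nat) (U : normedModType R)
    (h : U -> 'rV[R]_n.+2 * 'rV[R]_n.+2) x v : differentiable h x ->
  (\forall z \near x, unit_tangent (h z)) ->
  [/\ mink ('d h x v).1 (h x).1 = 0, mink ('d h x v).2 (h x).2 = 0 &
    mink ('d h x v).1 (h x).2 + mink ('d h x v).2 (h x).1 = 0].
Proof.
move=> dh Uh; have [d1 d2] := (differentiable_fst dh, differentiable_snd dh).
have e1 := diff_fstE v dh; have e2 := diff_sndE v dh.
have D11 : mink ('d h x v).1 (h x).1 + mink (h x).1 ('d h x v).1 = 0.
  apply: etrans (congr2 (fun p q => mink p _ + mink _ q) (esym e1) (esym e1)) _.
  by apply: (diff_mink_const (c := -1)) => //; apply: filterS Uh => z [[] -> ].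
have D22 : mink ('d h x v).2 (h x).2 + mink (h x).2 ('d h x v).2 = 0.
  apply: etrans (congr2 (fun p q => mink p _ + mink _ q) (esym e2) (esym e2)) _.
  by apply: (diff_mink_const (c := 1)) => //; apply: filterS Uh => z [_ _ ->].
have D12 : mink ('d h x v).1 (h x).2 + mink (h x).1 ('d h x v).2 = 0.
  apply: etrans (congr2 (fun p q => mink p _ + mink _ q) (esym e1) (esym e2)) _.
  by apply: (diff_mink_const (c := 0)) => //; apply: filterS Uh => z [_ -> _].
move: ('d h x v) D11 D22 D12 => xi; rewrite ![mink (h x).1 _]minkC ![mink (h x).2 _]minkC.
by move=> *; split; lra.
Qed.

Lemma tangent_pair (R : realType) (n : nat) (U : normedModType R)
    (a b : U -> 'rV[R]_n.+2) z v : differentiable a z -> differentiable b z ->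
  (\forall z \near z, unit_tangent (a z, b z)) ->
  [/\ mink ('d a z v) (a z) = 0, mink ('d b z v) (b z) = 0 &
    mink ('d a z v) (b z) + mink ('d b z v) (a z) = 0].
Proof.
move=> da db UT; have := tangent_unit_tangent v (differentiable_pair da db) UT.
have := diff_pairE v da db; move: ('d (fun z => (a z, b z)) z v).
by move=> xi ->.
Qed.

(** * The differential of the projection onto the space of geodesics *)

(** The chart is constant along each orbit of the flow. *)
Lemma extension_flow (R : realType) (n : nat) (psi : chart R _ (n + n)) y O F :
  unit_tangent y -> extension_at (@unit_tangent R n) (chart_map psi \o @proj R n) y O F ->
  'd F y (y.2, y.1) = 0.
Proof.
move=> Uy [oO Oy sF FE]; have dF := smooth_differentiable sF Oy.
have [dg dgE] := diff_flow0 y.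
have nO : \forall t \near 0, O (geodesic_flow t y).
  apply: (differentiable_continuous dg); rewrite flow0.
  exact: open_nbhs_nbhs.
have dP : differentiable (F - cst (F y)) y by apply: differentiableB.
have dPE v : 'd (F - cst (F y)) y v = 'd F y v.
  apply: etrans (congr1 (@^~ v) (diffB dF (differentiable_cst (F y) y))) _.
  by apply: etrans (subr0 _); congr (_ - _); exact: diff_cstE.
rewrite -dgE -dPE; apply: (curve_vanish dP dg (flow0 y)).
apply: filterS nO => t Ot.
by rewrite !fctE (FE _ Ot (unit_tangent_flow t Uy)) (FE _ Oy Uy) /= proj_flow subrr.
Qed.

(** Two extensions differ by a map that vanishes on the unit tangent bundle,
    so that the one selected in the definition of the differential does not
    matter. *)
Lemma dproj_extension (R : realType) (n : nat) (psi : chart R _ (n + n)) y O F xi :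
  unit_tangent y -> extension_at (@unit_tangent R n) (chart_map psi \o @proj R n) y O F ->
  chi_orth y xi -> dproj psi y xi = 'd F y xi.
Proof.
move=> Uy ext ort; rewrite /dproj /sub_diff; case: xgetP => [a Ea [OO [F' [ext' Ea']]]|].
  rewrite Ea' {Ea Ea'}.
  have [oO Oy sF FE] := ext; have [oOO OOy sF' FE'] := ext'.
  have dF := smooth_differentiable sF Oy; have dF' := smooth_differentiable sF' OOy.
  have dP : differentiable (F' - F) y by apply: differentiableB.
  have nO : \forall z \near y, O z by apply: open_nbhs_nbhs.
  have nO' : \forall z \near y, OO z by apply: open_nbhs_nbhs.
  apply/eqP; rewrite -subr_eq0; apply/eqP.
  apply: etrans (esym (congr1 (@^~ xi) (diffB dF' dF))) _.
  apply: (vanish_tangent Uy dP _ ort).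
  near=> z => Uz; rewrite !fctE FE' ?FE ?subrr //; by near: z.
by move=> /(_ ('d F y xi)) []; exists O, F.
Unshelve. all: by end_near. Qed.

(** A local section [s] of the projection recovers each unit tangent vector
    [z] up to the flow, with coefficients read off by Minkowski products.
    Differentiating this relation in a direction [xi] killed by ['d F], the
    section does not vary, and [xi] turns out to be zero. *)
Lemma extension_injective (R : realType) (n : nat) (psi : chart R _ (n + n)) y O F xi :
  geodesic_atlas psi -> unit_tangent y -> chart_dom psi (proj y) ->
  extension_at (@unit_tangent R n) (chart_map psi \o @proj R n) y O F ->
  chi_orth y xi -> 'd F y xi = 0 -> xi = 0.
Proof.
move=> [[_ _ invK] [lift sect]] Uy dy [oO Oy sF FE] ort F0.
have Fy : F y = chart_map psi (proj y) by exact: FE.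
have img : chart_img psi (F y) by rewrite Fy; exists (proj y).
have [Oa [s [oOa Oay sub ss sP]]] := sect _ img.
have [OO [F' [[oOO OOy _ _] dom]]] := lift y Uy dy.
have dF := smooth_differentiable sF Oy.
have ds := smooth_differentiable ss Oay.
pose S z := s (F z).
have dS : differentiable S y by exact: (differentiable_comp dF ds).
have ES : 'd S y xi = 0 by rewrite (diff_compE xi dF ds) F0 linear0.
have flowS z : O z -> OO z -> Oa (F z) -> unit_tangent z ->
    exists t, S z = geodesic_flow t z.
  move=> Oz OOz Oaz Uz; apply: proj_eq_flow.
  by have [_ ->] := sP _ Oaz; rewrite FE //= invK //; exact: dom.
have near_flow : \forall z \near y, unit_tangent z -> exists t, S z = geodesic_flow t z.
  have n1 : \forall z \near y, O z by apply: open_nbhs_nbhs.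
  have n2 : \forall z \near y, OO z by apply: open_nbhs_nbhs.
  have n3 : \forall z \near y, Oa (F z).
    by apply: (differentiable_continuous dF); apply: open_nbhs_nbhs.
  by near=> z; apply: flowS; near: z.
have [dS1 dS2] := (differentiable_fst dS, differentiable_snd dS).
have ES1 : 'd (fun z => (S z).1) y xi = 0 by rewrite diff_fstE // ES.
have ES2 : 'd (fun z => (S z).2) y xi = 0 by rewrite diff_sndE // ES.
have di : differentiable (@id ('rV[R]_n.+2 * 'rV[R]_n.+2)%type) y by exact: ex_diff.
have [d1 d2] := (differentiable_fst di, differentiable_snd di).
have E1 : 'd (fun z : 'rV[R]_n.+2 * 'rV[R]_n.+2 => z.1) y xi = xi.1.
  by rewrite (diff_fstE xi di) diff_val.
have E2 : 'd (fun z : 'rV[R]_n.+2 * 'rV[R]_n.+2 => z.2) y xi = xi.2.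
  by rewrite (diff_sndE xi di) diff_val.
have [t St] := nbhs_singleton near_flow Uy.
have [x1 x2 u1 u2] := ort.
have [ct st] := flow_coord t Uy.
have [dm1 m1] := diff_minkE xi dS1 d1; have [dm2 m2] := diff_minkE xi dS1 d2.
have M1 : 'd (fun z => mink (S z).1 z.1) y xi = 0.
  apply: etrans m1 (etrans (congr2 (fun u v => mink u y.1 + mink (S y).1 v) ES1 E1) _).
  by rewrite St /= !minkE ![mink _ xi.1]minkC x1 x2 !mulr0 !addr0.
have M2 : 'd (fun z => mink (S z).1 z.2) y xi = 0.
  apply: etrans m2 (etrans (congr2 (fun u v => mink u y.2 + mink (S y).1 v) ES1 E2) _).
  by rewrite St /= !minkE ![mink _ xi.2]minkC u1 u2 !mulr0 !addr0.
have [d11 e11] := diff_scaleE xi dm1 d1; have [d12 e12] := diff_scaleE xi dm1 d2.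
have [d21 e21] := diff_scaleE xi dm2 d1; have [d22 e22] := diff_scaleE xi dm2 d2.
(* [S z] is the flow of [z] for a time whose [cosh] and [sinh] are the products
   [- mink (S z).1 z.1] and [mink (S z).1 z.2] *)
have near1 : \forall z \near y, unit_tangent z ->
    (S z).1 + mink (S z).1 z.1 *: z.1 - mink (S z).1 z.2 *: z.2 = 0.
  apply: filterS near_flow => z H Uz; have [r Sz] := H Uz.
  have [cr sr] := flow_coord r Uz.
  rewrite Sz -sr -[mink _ z.1]opprK -cr /= scaleNr.
  by rewrite [X in X - _ - _]addrC addrK subrr.
have near2 : \forall z \near y, unit_tangent z ->
    (S z).2 - mink (S z).1 z.2 *: z.1 + mink (S z).1 z.1 *: z.2 = 0.
  apply: filterS near_flow => z H Uz; have [r Sz] := H Uz.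
  have [cr sr] := flow_coord r Uz.
  rewrite Sz -sr -[mink _ z.1]opprK -cr /= scaleNr.
  by rewrite [X in X - _ - _]addrC addrK subrr.
have dA := differentiableD dS1 d11; have dB := differentiableB dS2 d21.
have V1 := vanish_tangent Uy (differentiableB dA d22) near1 ort.
have V2 := vanish_tangent Uy (differentiableD dB d12) near2 ort.
have My1 : mink (S y).1 y.1 = - cosh t by rewrite ct opprK -St.
have My2 : mink (S y).1 y.2 = sinh t by rewrite st -St.
have D11 : 'd (fun z => mink (S z).1 z.1 *: z.1) y xi = - cosh t *: xi.1.
  apply: etrans e11 (etrans (congr2 (fun p q => p *: y.1 + _ *: q) M1 E1) _).
  by rewrite My1 scale0r add0r.
have D12 : 'd (fun z => mink (S z).1 z.1 *: z.2) y xi = - cosh t *: xi.2.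
  apply: etrans e12 (etrans (congr2 (fun p q => p *: y.2 + _ *: q) M1 E2) _).
  by rewrite My1 scale0r add0r.
have D21 : 'd (fun z => mink (S z).1 z.2 *: z.1) y xi = sinh t *: xi.1.
  apply: etrans e21 (etrans (congr2 (fun p q => p *: y.1 + _ *: q) M2 E1) _).
  by rewrite My2 scale0r add0r.
have D22 : 'd (fun z => mink (S z).1 z.2 *: z.2) y xi = sinh t *: xi.2.
  apply: etrans e22 (etrans (congr2 (fun p q => p *: y.2 + _ *: q) M2 E2) _).
  by rewrite My2 scale0r add0r.
have {}V1 : - cosh t *: xi.1 - sinh t *: xi.2 = 0.
  have A1 := etrans (diffDE xi dS1 d11) (congr2 +%R ES1 D11).
  have A2 := etrans (diffBE xi dA d22) (congr2 (fun p q => p - q) A1 D22).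
  by apply: etrans _ (etrans (esym A2) V1); rewrite add0r.
have {}V2 : - sinh t *: xi.1 - cosh t *: xi.2 = 0.
  have A1 := etrans (diffBE xi dS2 d21) (congr2 (fun p q => p - q) ES2 D21).
  have A2 := etrans (diffDE xi dB d12) (congr2 +%R A1 D12).
  by apply: etrans _ (etrans (esym A2) V2); rewrite add0r !scaleNr.
have C := cosh_sq t.
(* invert the hyperbolic rotation *)
have X1 : xi.1 = - cosh t *: (- cosh t *: xi.1 - sinh t *: xi.2)
   + sinh t *: (- sinh t *: xi.1 - cosh t *: xi.2).
  rewrite !scalerBr !scalerA addrACA -opprD -scalerDl -scalerDl.
  have -> : - cosh t * - cosh t + sinh t * - sinh t = 1 by rewrite -C; ring.
  by rewrite mulNr [cosh t * _]mulrC addNr scale0r subr0 scale1r.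
have X2 : xi.2 = - cosh t *: (- sinh t *: xi.1 - cosh t *: xi.2)
   + sinh t *: (- cosh t *: xi.1 - sinh t *: xi.2).
  rewrite !scalerBr !scalerA addrACA -opprD -scalerDl -scalerDl.
  have -> : - cosh t * cosh t + sinh t * sinh t = - 1 by rewrite -C; ring.
  by rewrite mulrNN mulrN [cosh t * _]mulrC subrr scale0r add0r scaleN1r opprK.
rewrite V1 V2 !scaler0 addr0 in X1; rewrite V1 V2 !scaler0 addr0 in X2.
exact: injective_projections.
Unshelve. all: by end_near. Qed.

Lemma hor_lift_dproj (R : realType) (n : nat) (psi : chart R _ (n + n)) y zeta :
  geodesic_atlas psi -> unit_tangent y -> chart_dom psi (@proj R n y) ->
  chi_orth y zeta -> hor_lift psi y (dproj psi y zeta) = zeta.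
Proof.
move=> psiA Uy dy ort; have [_ [lift _]] := psiA.
have [OO [F [ext _]]] := lift y Uy dy.
rewrite /hor_lift.
have [orx E] := xgetI 0 (P := [set xi | chi_orth y xi /\ dproj psi y xi = dproj psi y zeta])
  (conj ort erefl).
move: (xget _ _) orx E => x orx.
rewrite (dproj_extension Uy ext orx) (dproj_extension Uy ext ort) => E.
have orB : chi_orth y (x - zeta).
  move: orx ort => [a b c d] [a' b' c' d'].
  by split; rewrite /= !minkE ?a ?b ?c ?d ?a' ?b' ?c' ?d' subrr.
apply/eqP; rewrite -subr_eq0; apply/eqP.
apply: (extension_injective psiA Uy dy ext orB).
by apply: etrans (linearB _ _ _) _; apply/eqP; rewrite subr_eq0; apply/eqP.
Qed.

Lemma rep_flow (R : realType) (n : nat) (y : 'rV[R]_n.+2 * 'rV[R]_n.+2) :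
  unit_tangent y -> unit_tangent (rep (proj y)) /\
    exists t, rep (proj y) = geodesic_flow t y.
Proof.
move=> Uy; have [Ur Er] := xgetI 0 (P := [set z | unit_tangent z /\ proj z = proj y])
  (conj Uy erefl).
by split=> //; exact: proj_eq_flow.
Qed.

(** The form [omega] is invariant under the flow and vanishes on its
    direction, so that neither the chosen representative nor the component
    of the lifted vectors along the flow matters: the symplectic form can be
    computed as [omega] on any local lift. *)
Lemma para_symplectic_lift (R : realType) (n m : nat) (psi : chart R _ (n + n))
    (f : 'rV[R]_m -> 'rV[R]_n.+2 * 'rV[R]_n.+2) (g : 'rV[R]_m -> 'rV[R]_(n + n)) z0 X Y :
  geodesic_atlas psi -> chart_dom psi (proj (f z0)) -> differentiable f z0 ->
  (\forall z \near z0, unit_tangent (f z)) ->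
  (\forall z \near z0, g z = chart_map psi (proj (f z))) ->
  para_symplectic psi (proj (f z0)) ('d g z0 X) ('d g z0 Y)
    = omega ('d f z0 X) ('d f z0 Y).
Proof.
move=> psiA dom df Uf gE; have [_ [lift _]] := psiA.
have Uy := nbhs_singleton Uf.
have [Ur [t rE]] := rep_flow Uy; set r := rep _ in Ur rE *.
have dr : chart_dom psi (proj r) by rewrite rE proj_flow.
have [OO [F [ext _]]] := lift r Ur dr; have [oO Or sF FE] := ext.
have dF := smooth_differentiable sF Or.
(* move the lift along the flow, to make it pass through the representative *)
pose h z := geodesic_flow t (f z).
have cfl := @flow_continuous R n t.
have dh : differentiable h z0 by exact: differentiable_lin.
have hE v : 'd h z0 v = geodesic_flow t ('d f z0 v) by exact: diff_linE.
have hr : h z0 = r by rewrite rE.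
have dFh : differentiable F (h z0) by rewrite hr.
have nO : \forall z \near z0, OO (h z).
  by apply: (differentiable_continuous dh); rewrite hr; apply: open_nbhs_nbhs.
have gFh : \forall z \near z0, (F \o h) z = g z.
  near=> z.
  have -> : g z = chart_map psi (proj (f z)) by near: z.
  have Ofz : OO (h z) by near: z.
  have Ufz : unit_tangent (f z) by near: z.
  by rewrite /= (FE _ Ofz (unit_tangent_flow t Ufz)) /= proj_flow.
have [_ dgE] := near_differentiable gFh (differentiable_comp dh dFh).
have gX v : 'd g z0 v = 'd F r ('d h z0 v).
  apply: etrans (congr1 (@^~ v) dgE) _; rewrite -hr; exact: diff_compE.
have Uh : \forall z \near z0, unit_tangent (h z).
  by apply: filterS Uf => z Uz; exact: unit_tangent_flow.
have tan v := tangent_unit_tangent v dh Uh; rewrite hr in tan.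
have [[Exx _] Exv Evv] := Ur; have Evx := etrans (minkC _ _) Exv.
(* remove the component along the flow *)
pose c v := mink ('d h z0 v).1 r.2.
pose eta v := 'd h z0 v - c v *: (r.2, r.1).
have ort v : chi_orth r (eta v).
  have [t1 t2 t3] := tan v.
  split; rewrite /= !minkE ?t1 ?t2 ?Evx ?Evv ?Exx ?Exv /c; move: t3; lra.
have gdp v : 'd g z0 v = dproj psi r (eta v).
  rewrite gX (dproj_extension Ur ext (ort v)).
  have S : 'd F r (eta v) = 'd F r ('d h z0 v) - 'd F r (c v *: (r.2, r.1)).
    exact: linearB.
  have Z : 'd F r (c v *: (r.2, r.1)) = 0.
    have Z1 : 'd F r (c v *: (r.2, r.1)) = c v *: 'd F r (r.2, r.1) by exact: linearZ.
    by apply: etrans Z1 _; rewrite (extension_flow Ur ext) scaler0.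
  by apply: esym (etrans S (etrans (congr2 (fun p q => p - q) erefl Z) _)); rewrite subr0.
have orts v : chi_orth r ((eta v).2, (eta v).1) by have [? ? ? ?] := ort v; split.
rewrite /para_symplectic /para_complex /para_metric -/r !gdp.
rewrite (hor_lift_dproj psiA Ur dr (ort X)) (hor_lift_dproj psiA Ur dr (ort Y)).
rewrite (hor_lift_dproj psiA Ur dr (orts Y)).
apply: etrans _ (omega_flow t _ _); rewrite /omega -(hE X) -(hE Y).
have [X1 X2 X3] := tan X; have [Y1 Y2 Y3] := tan Y.
rewrite /eta /c; move: ('d h z0 X) ('d h z0 Y) X1 X2 X3 Y1 Y2 Y3 => x y.
move=> X1 X2 X3 Y1 Y2 Y3 /=.
rewrite !minkE [mink r.1 y.1]minkC [mink r.2 y.2]minkC Exv Evx X1 X2 Y1 Y2.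
ring.
Unshelve. all: by end_near. Qed.

(** * Charts *)

Lemma chart_invP (R : realType) (T : topologicalType) d (phi : chart R T d) z :
  is_homeo_chart phi -> chart_img phi z ->
  chart_dom phi (chart_inv phi z) /\ chart_map phi (chart_inv phi z) = z.
Proof. by move=> [_ _ _ _ K] [p dp <-]; rewrite K. Qed.

Lemma near_chart_inv (R : realType) (T : topologicalType) d (phi : chart R T d)
    p (P : T -> Prop) : is_homeo_chart phi -> chart_dom phi p ->
  (\forall q \near p, P q) ->
  \forall z \near chart_map phi p,
    [/\ chart_img phi z, P (chart_inv phi z) & chart_dom phi (chart_inv phi z)].
Proof.
move=> H dp nP; have [_ oi _ ci K] := H.
have ip : chart_img phi (chart_map phi p) by exists p.
have cp : {for chart_map phi p, continuous (chart_inv phi)}.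
  by move: ci; rewrite continuous_open_subspace // => /(_ _ (mem_set ip)).
have ni : \forall z \near chart_map phi p, chart_img phi z by apply: open_nbhs_nbhs.
have nz : \forall z \near chart_map phi p, P (chart_inv phi z).
  by apply: cp; rewrite K.
near=> z; have iz : chart_img phi z by near: z.
split=> //; first by near: z.
by have [] := chart_invP H iz.
Unshelve. all: by end_near. Qed.

Lemma near_chart_map (R : realType) (T : topologicalType) d (phi : chart R T d)
    p (P : 'rV[R]_d -> Prop) : is_homeo_chart phi -> chart_dom phi p ->
  (\forall z \near chart_map phi p, P z) ->
  \forall q \near p, chart_dom phi q /\ P (chart_map phi q).
Proof.
move=> H dp nP; have [od _ cm _ _] := H.
have cp : {for p, continuous (chart_map phi)}.
  by move: cm; rewrite continuous_open_subspace // => /(_ _ (mem_set dp)).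
have nd : \forall q \near p, chart_dom phi q by apply: open_nbhs_nbhs.
by apply: filterI => //; apply: cp.
Qed.

Lemma transition_differentiable (R : realType) n (M : manifold R n)
    (phi psi : chart R M n) p :
  atlas phi -> atlas psi -> chart_dom phi p -> chart_dom psi p ->
  differentiable (transition phi psi) (chart_map phi p).
Proof.
move=> Aphi Apsi dphi dpsi.
by apply: smooth_differentiable (manifold_compatible Aphi Apsi) _ _; exists p.
Qed.

(** The chain rule for a change of charts of the source. *)
Lemma diff_change_chart (R : realType) n (M : manifold R n) (W : normedModType R)
    (phi psi : chart R M n) (h : M -> W) p :
  atlas phi -> atlas psi -> chart_dom phi p -> chart_dom psi p ->
  differentiable (h \o chart_inv psi) (chart_map psi p) ->
  differentiable (h \o chart_inv phi) (chart_map phi p) /\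
  forall v, 'd (h \o chart_inv phi) (chart_map phi p) v =
    'd (h \o chart_inv psi) (chart_map psi p)
       ('d (transition phi psi) (chart_map phi p) v).
Proof.
move=> Aphi Apsi dphi dpsi dh.
have Hphi := manifold_charts Aphi; have Hpsi := manifold_charts Apsi.
have dT := transition_differentiable Aphi Apsi dphi dpsi.
have Kphi : chart_inv phi (chart_map phi p) = p by case: Hphi => _ _ _ _; exact.
have Kpsi q : chart_dom psi q -> chart_inv psi (chart_map psi q) = q.
  by case: Hpsi => _ _ _ _; exact.
have Tp : transition phi psi (chart_map phi p) = chart_map psi p.
  by rewrite /transition /= Kphi.
have dh' : differentiable (h \o chart_inv psi) (transition phi psi (chart_map phi p)).
  by rewrite Tp.
have E : \forall z \near chart_map phi p,
    ((h \o chart_inv psi) \o transition phi psi) z = (h \o chart_inv phi) z.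
  have nd : \forall q \near p, chart_dom psi q.
    by case: Hpsi => od _ _ _ _; apply: open_nbhs_nbhs.
  by apply: filterS (near_chart_inv Hphi dphi nd) => z [_ dz _]; rewrite /= Kpsi.
have [D DE] := near_differentiable E (differentiable_comp dT dh').
split=> // v; apply: etrans (congr1 (@^~ v) DE) _.
by apply: etrans (diff_compE v dT dh') _; rewrite Tp.
Qed.

Lemma transition_diffK (R : realType) n (M : manifold R n)
    (phi psi : chart R M n) p v :
  atlas phi -> atlas psi -> chart_dom phi p -> chart_dom psi p ->
  'd (transition psi phi) (chart_map psi p)
     ('d (transition phi psi) (chart_map phi p) v) = v.
Proof.
move=> Aphi Apsi dphi dpsi.
have dT := transition_differentiable Apsi Aphi dpsi dphi.
have [_ E] := diff_change_chart Aphi Apsi dphi dpsi dT.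
apply: etrans (esym (E v)) _.
have Hphi := manifold_charts Aphi.
have I : \forall z \near chart_map phi p, id z = (chart_map phi \o chart_inv phi) z.
  apply: filterS (near_chart_inv Hphi dphi filterT) => z [iz _ _] /=.
  by have [_ ->] := chart_invP Hphi iz.
have did : differentiable (@id 'rV[R]_n) (chart_map phi p) by exact: ex_diff.
have [_ E1] := near_differentiable I did.
apply: etrans (congr1 (@^~ v) E1) _.
by rewrite diff_val.
Qed.

Lemma transition_det_neq0 (R : realType) (n : nat) (M : manifold R n)
    (phi psi : chart R M n) p :
  atlas phi -> atlas psi -> chart_dom phi p -> chart_dom psi p ->
  \det ('J (transition phi psi) (chart_map phi p)) != 0.
Proof.
move=> Aphi Apsi dphi dpsi.
apply/negP => /det0P [v v0]; rewrite /jacobian mul_rV_lin1 => E.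
move/eqP: v0; apply; apply: etrans (esym (transition_diffK v Aphi Apsi dphi dpsi)) _.
by apply: etrans (congr1 _ E) _; exact: linear0.
Qed.

Lemma cvg_det (R : realType) (m : nat) (T : Type) (F : set_system T) {FF : Filter F}
    (f : T -> 'M[R]_m) (A : 'M[R]_m) :
  (forall i j, f t i j @[t --> F] --> A i j) -> \det (f t) @[t --> F] --> \det A.
Proof.
move=> H; have cm : continuous (fun x : R * R => x.1 * x.2) by exact: mul_continuous.
have ca : continuous (fun x : R * R => x.1 + x.2) by exact: add_continuous.
have P (s : {perm 'I_m}) : \prod_i f t i (s i) @[t --> F] --> \prod_i A i (s i).
  exact: (@cvg_big R 'I_m ( *%R : R -> R -> R) 1 predT cm _ _ (index_enum 'I_m)
    (fun i t => f t i (s i)) (fun i => A i (s i)) FF (fun i _ => H i (s i))).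
have Q (s : {perm 'I_m}) : (-1) ^+ s * \prod_i f t i (s i) @[t --> F]
    --> (-1) ^+ s * \prod_i A i (s i).
  exact: cvgM (cvg_cst _) (P s).
exact: (@cvg_big R _ (+%R : R -> R -> R) 0 predT ca _ _ (index_enum {perm 'I_m})
  (fun s t => (-1) ^+ s * \prod_i f t i (s i))
  (fun s => (-1) ^+ s * \prod_i A i (s i)) FF (fun s _ => Q s)).
Qed.

Lemma sg_near (R : realType) (T : Type) (F : set_system T) {FF : Filter F}
    (f : T -> R) (y : R) : f t @[t --> F] --> y -> y != 0 ->
  \forall t \near F, Num.sg (f t) = Num.sg y.
Proof.
move=> fy; rewrite neq_lt => /orP[y0|y0].
  near=> t; rewrite !ltr0_sg //; near: t.
  exact: (cvgr_lt _ fy _ y0).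
near=> t; rewrite !gtr0_sg //; near: t.
exact: (cvgr_gt _ fy _ y0).
Unshelve. all: by end_near. Qed.

Lemma near_eq_cvg_to (T : Type) (U : topologicalType) (F : set_system T)
    {FF : Filter F} (f g : T -> U) (a b : U) :
  (\forall t \near F, g t = f t) -> b = a -> f @ F --> a -> g @ F --> b.
Proof. by move=> H ->; apply: cvg_trans; apply: near_eq_cvg; apply: filterS H. Qed.

Lemma transition_det_cvg (R : realType) (n : nat) (M : manifold R n)
    (phi psi : chart R M n) p :
  atlas phi -> atlas psi -> chart_dom phi p -> chart_dom psi p ->
  \det ('J (transition phi psi) (chart_map phi q)) @[q --> p]
    --> \det ('J (transition phi psi) (chart_map phi p)).
Proof.
move=> Aphi Apsi dphi dpsi; apply: cvg_det => i j.
have sT := manifold_compatible Aphi Apsi.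
have Hphi := manifold_charts Aphi; have Hpsi := manifold_charts Apsi.
have dT z : (chart_map phi @` (chart_dom phi `&` chart_dom psi)) z ->
    'J (transition phi psi) z i j = entry j ('D_(delta_mx 0 i) (transition phi psi) z).
  move=> Dz; rewrite /jacobian mxE /entry; congr (fun_of_matrix _ 0 j).
  exact: esym (deriveE _ (smooth_differentiable sT Dz)).
have Dp : (chart_map phi @` (chart_dom phi `&` chart_dom psi)) (chart_map phi p).
  by exists p.
have cD : entry j ('D_(delta_mx 0 i) (transition phi psi) z) @[z --> chart_map phi p]
    --> entry j ('D_(delta_mx 0 i) (transition phi psi) (chart_map phi p)).
  exact: cvg_comp (smooth_continuous (smooth_derive sT (delta_mx 0 i)) Dp)
    (@entry_continuous R n j _).
have cphi : chart_map phi q @[q --> p] --> chart_map phi p.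
  by move=> P nP; apply: filterS (near_chart_map Hphi dphi nP) => q [].
have nd : \forall q \near p, chart_dom phi q /\ chart_dom psi q.
  have [oph _ _ _ _] := Hphi; have [ops _ _ _ _] := Hpsi.
  by apply: filterI; apply: open_nbhs_nbhs.
apply: (near_eq_cvg_to _ (dT _ Dp) (cvg_comp _ _ cphi cD)).
by apply: filterS nd => q [e1 e2]; apply: dT; exists q.
Qed.

(** Composing [G], read in charts, with a smooth local section of the
    projection lifts it to the unit tangent bundle; one ball serves for all
    the conditions. *)
Lemma local_lift (R : realType) (n : nat) (M : manifold R n)
    (G : M -> set ('rV[R]_n.+2 * 'rV[R]_n.+2)) p :
  smooth_map (@atlas R n M) (@geodesic_atlas R n) setT G ->
  exists phi psi r (lft : 'rV[R]_n -> 'rV[R]_n.+2 * 'rV[R]_n.+2),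
    [/\ atlas phi, geodesic_atlas psi, chart_dom phi p & 0 < r] /\
    [/\ ball (chart_map phi p) r `<=` chart_img phi,
        smooth_on (ball (chart_map phi p) r) (local_rep phi psi G),
        smooth_on (ball (chart_map phi p) r) lft &
        forall z, ball (chart_map phi p) r z ->
          [/\ unit_tangent (lft z), proj (lft z) = G (chart_inv phi z) &
              chart_dom psi (G (chart_inv phi z))]].
Proof.
move=> /(_ p I) [phi [psi [Q [[Aphi Apsi dphi] [oQ Qp Qi Qd sQ]]]]].
have [[_ _ Kpsi] [_ sect]] := Apsi.
have img z : Q z -> chart_img psi (local_rep phi psi G z).
  by move=> Qz; exists (G (chart_inv phi z)) => //; exact: Qd.
have [P [s [oP Pp Pi ss sP]]] := sect _ (img _ Qp).
have nr : \forall z \near chart_map phi p, Q z /\ P (local_rep phi psi G z).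
  apply: filterI; first by apply: open_nbhs_nbhs.
  by apply: (smooth_continuous sQ Qp); apply: open_nbhs_nbhs.
have [r /= r0 rP] := (nbhs_ballP _ _).1 nr.
exists phi, psi, r, (s \o local_rep phi psi G); split=> //.
have sB : smooth_on (ball (chart_map phi p) r) (local_rep phi psi G).
  by move=> k; apply: Ck_sub (sQ k) => z /rP[].
split=> //.
- by move=> z /rP[/Qi].
- by apply: smooth_comp sB ss => //; [exact: ball_open|move=> z /rP[]].
- move=> z /rP[Qz Pz]; have [Us ps] := sP _ Pz.
  by split=> //; [rewrite /= ps Kpsi //; exact: Qd|exact: Qd].
Qed.

(** * Gauss maps are Lagrangian *)

(** The normal cannot be the default value [0]: a Gauss map takes values in
    the geodesics, so that the base point and the normal form a unit tangent
    vector. *)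
Lemma unit_normal_spec (R : realType) (n : nat) (M : manifold R n)
    (o : chart R M n -> M -> R) (s : M -> 'rV[R]_n.+2) p :
  geodesics (gauss_map o s p) ->
  unit_tangent (s p, unit_normal o s p) /\
  forall phi, atlas phi -> chart_dom phi p ->
    (forall X, mink (unit_normal o s p) (diff_in phi s p X) = 0) /\
    0 < o phi p * \det (frame_mx phi s (unit_normal o s p) p).
Proof.
move=> [y Uy]; rewrite /gauss_map => /esym E.
have [t Et] := proj_eq_flow E.
have U : unit_tangent (s p, unit_normal o s p) by rewrite Et; exact: unit_tangent_flow.
split=> //; have [_ _ /= N1] := U.
set P := [set nu | [/\ mink nu (s p) = 0, mink nu nu = 1 &
        forall phi, atlas phi -> chart_dom phi p ->
          (forall X, mink nu (diff_in phi s p X) = 0) /\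
          0 < o phi p * \det (frame_mx phi s nu p)]].
have [ex|nex] := pselect (exists nu, P nu).
  by have [_ _] := xgetPex 0 ex.
have N0 : unit_normal o s p = 0.
  by apply: (@xgetPN _ 0 P) => nu Pnu; apply: nex; exists nu.
by move: N1; rewrite N0 mink0l => /esym /eqP; rewrite oner_eq0.
Qed.

(** The relation [mink N (dS) = 0] says that [(S, N)] has zero Liouville
    form. Differentiating it, the second derivatives of [S] cancel by
    symmetry in the skew part, which is the pullback of [omega] by [(S, N)]. *)
Lemma normal_lift_omega (R : realType) (n m : nat) (O : set 'rV[R]_m)
    (S N : 'rV[R]_m -> 'rV[R]_n.+2) z0 X Y :
  open O -> O z0 -> Ck 2 O S -> differentiable N z0 ->
  (\forall z \near z0, forall v, mink (N z) ('d S z v) = 0) ->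
  omega ('d (fun z => (S z, N z)) z0 X) ('d (fun z => (S z, N z)) z0 Y) = 0.
Proof.
move=> oO Oz0 CS dN perp; have [dS dS'] := CS.
have dS0 := dS _ Oz0.
have nO : \forall z \near z0, O z by apply: open_nbhs_nbhs.
have dd v : differentiable ('D_v S) z0 by have [d _] := dS' v; exact: d.
have H u v : mink ('d N z0 u) ('d S z0 v) + mink (N z0) ('D_u ('D_v S) z0) = 0.
  have K : \forall z \near z0, 0 = mink (N z) ('D_v S z).
    near=> z; have Oz : O z by near: z.
    have -> : 'D_v S z = 'd S z v by rewrite deriveE //; exact: dS.
    have perpz : forall v, mink (N z) ('d S z v) = 0 by near: z.
    by rewrite perpz.
  apply: etrans (diff_mink_const u dN (dd v) K).
  exact: (congr2 (fun p q => mink _ p + mink _ q) (esym (deriveE v dS0)) (deriveE u (dd v))).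
have E : 'D_X ('D_Y S) z0 = 'D_Y ('D_X S) z0 by exact: (derive_comm_rV _ _ oO Oz0 CS).
have HX := H X Y; have HY := H Y X.
have alg (p q r c d : R) : p + c = 0 -> q + d = 0 -> c = d -> r = q -> r - p = 0.
  by clear; lra.
apply: etrans (omega_pair X Y dS0 dN) _.
exact: (alg _ _ _ _ _ HX HY (congr1 (mink (N z0)) E) (minkC _ _)).
Unshelve. all: by end_near. Qed.

(** The pair formed by [sigma] and its unit normal lifts [G] with zero
    Liouville form. The unit normal is only known pointwise: its
    differentiability comes from comparing this lift with a smooth one. *)
Lemma lagrangian_of_gauss (R : realType) (n : nat) (M : manifold R n)
    (G : M -> set ('rV[R]_n.+2 * 'rV[R]_n.+2)) :
  (forall p, geodesics (G p)) ->
  smooth_map (@atlas R n M) (@geodesic_atlas R n) setT G ->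
  (forall p : M, exists (U : set M) (sigma : M -> 'rV[R]_n.+2)
      (o : chart R M n -> M -> R),
    [/\ open U, U p,
        smooth_map (@atlas R n M) (@vector_atlas R n.+2) U sigma &
        forall q, U q -> gauss_map o sigma q = G q]) ->
  lagrangian G.
Proof.
move=> Ggeo sG HG p phi psi Aphi Apsi dphi dpsi X Y.
have [U [sigma [ori [oU Up ssig gauss]]]] := HG p.
have [phi2 [psi2 [Q [[Aphi2 Apsi2 dphi2] [oQ Qp Qi _ sQ]]]]] := ssig p Up.
have H2 := manifold_charts Aphi2.
set z2 := chart_map phi2 p in Qp.
pose S := sigma \o chart_inv phi2.
have {psi2 Apsi2} sQ : smooth_on Q S by move: sQ; rewrite Apsi2.
pose N z := unit_normal ori sigma (chart_inv phi2 z).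
have nU : \forall z \near z2, U (chart_inv phi2 z).
  have nU : \forall q \near p, U q by apply: open_nbhs_nbhs.
  by apply: filterS (near_chart_inv H2 dphi2 nU) => z [].
have spec z : U (chart_inv phi2 z) -> unit_tangent (S z, N z) /\
    forall phi, atlas phi -> chart_dom phi (chart_inv phi2 z) ->
    forall X, mink (N z) (diff_in phi sigma (chart_inv phi2 z) X) = 0.
  move=> Uz; have Gz := Ggeo (chart_inv phi2 z); rewrite -(gauss _ Uz) in Gz.
  have [UT H] := unit_normal_spec Gz; split=> // phi' A' d' V.
  by have [+ _] := H phi' A' d'; exact.
have nUT : \forall z \near z2, unit_tangent (S z, N z).
  by apply: filterS nU => z /spec[].
have K2 : chart_inv phi2 z2 = p by case: H2 => _ _ _ _; exact.
have nE : \forall z \near z2, [/\ chart_img phi2 z, True & chart_dom phi2 (chart_inv phi2 z)].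
  exact: near_chart_inv H2 dphi2 filterT.
(* the normal field is differentiable, being read off a smooth lift of [G] *)
have dN : differentiable N z2.
  have [phi3 [psi3 [r [lft [[Aphi3 _ dphi3 r0] [_ _ sl lP]]]]]] := local_lift p sG.
  have H3 := manifold_charts Aphi3.
  have B3 : ball (chart_map phi3 p) r (chart_map phi3 p) by exact: ballxx.
  have dT := transition_differentiable Aphi2 Aphi3 dphi2 dphi3.
  have T2 : transition phi2 phi3 z2 = chart_map phi3 p by rewrite /transition /= K2.
  have dl : differentiable (lft \o transition phi2 phi3) z2.
    apply: differentiable_comp => //; rewrite T2; exact: smooth_differentiable sl _ B3.
  pose a z := (lft (transition phi2 phi3 z)).1.
  pose b z := (lft (transition phi2 phi3 z)).2.
  have [da db] : differentiable a z2 /\ differentiable b z2.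
    by split; [exact: (differentiable_fst dl)|exact: (differentiable_snd dl)].
  have dS := smooth_differentiable sQ Qp.
  have n3 : \forall z \near z2, ball (chart_map phi3 p) r (transition phi2 phi3 z)
      /\ chart_dom phi3 (chart_inv phi2 z).
    have nd : \forall q \near p,
        chart_dom phi3 q /\ ball (chart_map phi3 p) r (chart_map phi3 q).
      apply: near_chart_map => //; exact: nbhsx_ballx.
    by apply: filterS (near_chart_inv H2 dphi2 nd) => z [_ [] ].
  have [d1 _] := diff_minkE 0 dS db; have [d2 _] := diff_minkE 0 dS da.
  have [d3 _] := diff_scaleE 0 d1 da; have [d4 _] := diff_scaleE 0 d2 db.
  have E : \forall z \near z2, mink (S z) (b z) *: a z - mink (S z) (a z) *: b z = N z.
    near=> z.
    have Uz : U (chart_inv phi2 z) by near: z.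
    have [Bz d3z] : ball (chart_map phi3 p) r (transition phi2 phi3 z)
      /\ chart_dom phi3 (chart_inv phi2 z) by near: z.
    have [Ul pl _] := lP _ Bz.
    have KT : chart_inv phi3 (transition phi2 phi3 z) = chart_inv phi2 z.
      by case: H3 => _ _ _ _; exact.
    rewrite KT -(gauss _ Uz) in pl.
    have [t Et] := proj_eq_flow (esym pl).
    have [ct st] := flow_coord t Ul; rewrite -Et /= in ct st.
    rewrite /a /b -st -scaleNr -ct.
    exact: esym (congr1 snd Et).
  by have [] := near_differentiable E (differentiableB d3 d4).
have dS := smooth_differentiable sQ Qp.
have perp : \forall z \near z2, forall v, mink (N z) ('d S z v) = 0.
  near=> z => v.
  have Uz : U (chart_inv phi2 z) by near: z.
  have [iz _ dz] : [/\ chart_img phi2 z, True & chart_dom phi2 (chart_inv phi2 z)] by near: z.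
  have [_ H] := spec z Uz; have := H _ Aphi2 dz v.
  by rewrite /diff_in; have [_ ->] := chart_invP H2 iz.
have om v w := normal_lift_omega v w oQ Qp (sQ 2) dN perp.
pose f z := (S z, N z).
have df : differentiable f z2 by exact: differentiable_pair.
have nG : \forall z \near z2, proj (f z) = G (chart_inv phi2 z).
  by apply: filterS nU => z Uz; rewrite -gauss.
have Gp : proj (f z2) = G p by rewrite (nbhs_singleton nG) K2.
pose g := (chart_map psi \o G) \o chart_inv phi2.
have gE : \forall z \near z2, g z = chart_map psi (proj (f z)).
  by apply: filterS nG => z E; rewrite E.
have dg : differentiable g z2.
  have Uf : unit_tangent (f z2) := nbhs_singleton nUT.
  have dpf : chart_dom psi (proj (f z2)) by rewrite Gp.
  have [_ [lift _]] := Apsi.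
  have [OO [F [[oO Of sF FE] _]]] := lift _ Uf dpf.
  have dF := smooth_differentiable sF Of.
  have E : \forall z \near z2, (F \o f) z = g z.
    have nO : \forall z \near z2, OO (f z).
      by apply: (differentiable_continuous df); apply: open_nbhs_nbhs.
    near=> z.
    have -> : g z = chart_map psi (proj (f z)) by near: z.
    by apply: FE; near: z.
  by have [] := near_differentiable E (differentiable_comp df dF).
have [_ ch] := diff_change_chart Aphi Aphi2 dphi dphi2 dg.
have psf : chart_dom psi (proj (f z2)) by rewrite Gp.
have PS := para_symplectic_lift ('d (transition phi phi2) (chart_map phi p) X)
  ('d (transition phi phi2) (chart_map phi p) Y) Apsi psf df nUT gE.
have TX v : tangent_map phi psi G p v = 'd g z2 ('d (transition phi phi2) (chart_map phi p) v).
  exact: ch.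
by rewrite !TX -Gp PS; exact: om.
Unshelve. all: by end_near. Qed.

(** * Frames *)

(** The block diagonal matrix with blocks [A] and [1], indexed so that the
    last index is the new one. *)
Definition bordered (R : realType) (m : nat) (A : 'M[R]_m) : 'M[R]_m.+1 :=
  \matrix_(i, j) match unlift ord_max i, unlift ord_max j with
    | Some k, Some l => A k l
    | None, None => 1
    | _, _ => 0 end.

Lemma det_bordered (R : realType) (m : nat) (A : 'M[R]_m) :
  \det (bordered A) = \det A.
Proof.
rewrite (expand_det_row _ ord_max) (bigD1 ord_max) //= big1 ?addr0; last first.
  move=> j jm; rewrite mxE unlift_none.
  by case: unliftP jm => [k ->|->]; rewrite ?eqxx ?mul0r.
rewrite mxE unlift_none mul1r /cofactor addnn -signr_odd odd_double mul1r.
by congr (\det _); apply/matrixP => i j; rewrite !mxE !liftK.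
Qed.

Lemma sum_ord_max (R : realType) (V : lmodType R) (m : nat) (F : 'I_m.+1 -> V) :
  \sum_i F i = \sum_(k < m) F (lift ord_max k) + F ord_max.
Proof.
rewrite big_ord_recr; congr (_ + _); apply: eq_bigr => i _; congr F.
by apply: val_inj; rewrite /= /bump leqNgt ltn_ord.
Qed.

Lemma frame_comb (R : realType) (n : nat) (M : manifold R n) (phi : chart R M n)
    (s : M -> 'rV[R]_n.+2) nu p (u : 'rV[R]_n.+2) :
  u *m frame_mx phi s nu p =
    diff_in phi s p (\row_k u 0 (lift ord_max (lift ord_max k)))
    + u 0 (lift ord_max ord_max) *: nu + u 0 ord_max *: s p.
Proof.
have -> : u *m frame_mx phi s nu p = \sum_i u 0 i *: row i (frame_mx phi s nu p).
  exact: mulmx_sum_row.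
rewrite sum_ord_max sum_ord_max; congr (_ + _ *: _ + _ *: _).
- apply: esym; apply: etrans (linear_rV_sum _ _) _; apply: eq_bigr => k _.
  rewrite /entry mxE; congr (_ *: _); apply/rowP => j.
  by rewrite !mxE !liftK.
- by apply/rowP => j; rewrite !mxE liftK unlift_none.
- by apply/rowP => j; rewrite !mxE unlift_none.
Qed.

(** The last two rows of a frame, the normal and the base point, are the
    same in all charts. *)
Lemma row_frame_change (R : realType) (n : nat) (M : manifold R n)
    (phi psi : chart R M n) (s : M -> 'rV[R]_n.+2) nu p (J : 'M[R]_n) :
  (forall v, diff_in phi s p v = diff_in psi s p (v *m J)) ->
  frame_mx phi s nu p = bordered (bordered J) *m frame_mx psi s nu p.
Proof.
move=> HJ; apply/row_matrixP => i; rewrite row_mul frame_comb; set u := row i (bordered _).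
case: (unliftP ord_max i) => [i'|] Ei.
  case: (unliftP ord_max i') => [k|] Ei'.
    have a0 : u 0 (lift ord_max ord_max) = 0.
      by rewrite !mxE Ei Ei' !liftK mxE liftK unlift_none.
    have b0 : u 0 ord_max = 0 by rewrite !mxE Ei !liftK unlift_none.
    rewrite a0 b0 !scale0r !addr0.
    have -> : row i (frame_mx phi s nu p) = diff_in phi s p (delta_mx 0 k).
      by apply/rowP => j; rewrite !mxE Ei Ei' !liftK.
    rewrite HJ -rowE; congr (diff_in _ _ _ _).
    by apply/rowP => j; rewrite !mxE Ei Ei' !liftK mxE !liftK.
  have a0 : u 0 (lift ord_max ord_max) = 1.
    by rewrite !mxE Ei Ei' !liftK mxE !unlift_none.
  have b0 : u 0 ord_max = 0 by rewrite !mxE Ei !liftK unlift_none.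
  have -> : (\row_k u 0 (lift ord_max (lift ord_max k))) = 0.
    by apply/rowP => j; rewrite !mxE Ei Ei' !liftK mxE liftK unlift_none.
  rewrite a0 b0 scale1r scale0r addr0 /diff_in linear0 add0r.
  by apply/rowP => j; rewrite !mxE Ei Ei' liftK unlift_none.
have a0 : u 0 (lift ord_max ord_max) = 0 by rewrite !mxE Ei unlift_none liftK.
have b0 : u 0 ord_max = 1 by rewrite !mxE Ei unlift_none.
have -> : (\row_k u 0 (lift ord_max (lift ord_max k))) = 0.
  by apply/rowP => j; rewrite !mxE Ei unlift_none liftK.
rewrite a0 b0 scale1r scale0r addr0 /diff_in linear0 add0r.
by apply/rowP => j; rewrite !mxE Ei unlift_none.
Qed.

Lemma det_frame_change (R : realType) (n : nat) (M : manifold R n)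
    (phi psi : chart R M n) (s : M -> 'rV[R]_n.+2) nu p :
  atlas phi -> atlas psi -> chart_dom phi p -> chart_dom psi p ->
  differentiable (s \o chart_inv psi) (chart_map psi p) ->
  \det (frame_mx phi s nu p) =
    \det ('J (transition phi psi) (chart_map phi p)) * \det (frame_mx psi s nu p).
Proof.
move=> Aphi Apsi dphi dpsi ds.
rewrite (@row_frame_change _ _ _ phi psi s nu p ('J (transition phi psi) (chart_map phi p))).
  by rewrite det_mulmx !det_bordered.
move=> v; have [_ E] := diff_change_chart Aphi Apsi dphi dpsi ds.
apply: etrans (E v) _; congr ('d _ _ _).
by rewrite /jacobian mul_rV_lin1.
Qed.

(** The normal and the base point are orthogonal to the image of the
    differential and to each other, and are not isotropic, so that a linear
    relation between the rows of the frame is a relation between the rows of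
    the differential. *)
Lemma det_frame_neq0 (R : realType) (n : nat) (M : manifold R n) (phi : chart R M n)
    (s : M -> 'rV[R]_n.+2) nu p :
  unit_tangent (s p, nu) -> (forall v, mink nu (diff_in phi s p v) = 0) ->
  (forall v, mink (s p) (diff_in phi s p v) = 0) ->
  \det (frame_mx phi s nu p) != 0 <->
  (forall v, diff_in phi s p v = 0 -> v = 0).
Proof.
move=> [/= [Exx _] Exv Evv] perpn perps; split=> [dn0 v Dv|inj].
  pose u : 'rV[R]_n.+2 := \row_i if unlift ord_max i is Some j then
    if unlift ord_max j is Some k then v 0 k else 0 else 0.
  have uv : (\row_k u 0 (lift ord_max (lift ord_max k))) = v.
    by apply/rowP => k; rewrite !mxE !liftK.
  have : u *m frame_mx phi s nu p = 0.
    rewrite frame_comb uv Dv !mxE !liftK !unlift_none.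
    by rewrite !scale0r !addr0.
  have unit : frame_mx phi s nu p \in unitmx by rewrite unitmxE unitfE.
  move/(congr1 (mulmx^~ (invmx (frame_mx phi s nu p)))).
  rewrite mulmxK // mul0mx => u0; rewrite -uv u0.
  by apply/rowP => k; rewrite !mxE.
apply/negP => /det0P [u u0]; rewrite frame_comb => E.
have b0 : u 0 ord_max = 0.
  have := congr1 (mink (s p)) E.
  rewrite !minkE perps Exv Exx mulr0 mulrN1 !add0r => /eqP.
  by rewrite oppr_eq0 => /eqP.
have a0 : u 0 (lift ord_max ord_max) = 0.
  have := congr1 (mink nu) E.
  by rewrite !minkE perpn Evv b0 mul0r mulr1 addr0 add0r.
move: E; rewrite a0 b0 !scale0r !addr0 => /inj V0.
move/eqP: u0; apply; apply/rowP => i; rewrite mxE.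
case: (unliftP ord_max i) => [i' ->|-> //].
case: (unliftP ord_max i') => [k ->|-> //].
by have := congr1 (fun w : 'rV[R]_n => w 0 k) V0; rewrite !mxE.
Qed.

Lemma det_frame_oppr (R : realType) (n : nat) (M : manifold R n) (phi : chart R M n)
    (s : M -> 'rV[R]_n.+2) nu p :
  \det (frame_mx phi s (- nu) p) = - \det (frame_mx phi s nu p).
Proof.
rewrite (@determinant_multilinear _ _ _ (frame_mx phi s nu p) (frame_mx phi s nu p)
  (lift ord_max ord_max) (- 1) 0).
- by rewrite mul0r addr0 mulN1r.
- rewrite scale0r addr0 scaleN1r; apply/rowP => j.
  by rewrite !mxE liftK unlift_none !mxE.
- apply/matrixP => i j; rewrite !mxE.
  case: (unliftP ord_max (lift _ i)) => [i' Ei|//].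
  case: (unliftP ord_max i') => [//|Ei'].
  by have := neq_lift (lift ord_max ord_max) i; rewrite Ei Ei' eqxx.
- apply/matrixP => i j; rewrite !mxE.
  case: (unliftP ord_max (lift _ i)) => [i' Ei|//].
  case: (unliftP ord_max i') => [//|Ei'].
  by have := neq_lift (lift ord_max ord_max) i; rewrite Ei Ei' eqxx.
Qed.

(** Expanding [nu'] in the frame of [nu] leaves only multiples of [nu], by
    definiteness on the orthogonal of the base point; the norm and the
    orientation fix the factor. *)
Lemma unit_normal_unique (R : realType) (n : nat) (M : manifold R n) (phi : chart R M n)
    (s : M -> 'rV[R]_n.+2) nu nu' p (c : R) :
  mink (s p) (s p) = -1 ->
  mink nu (s p) = 0 -> mink nu nu = 1 -> (forall v, mink nu (diff_in phi s p v) = 0) ->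
  mink nu' (s p) = 0 -> mink nu' nu' = 1 -> (forall v, mink nu' (diff_in phi s p v) = 0) ->
  (forall v, mink (s p) (diff_in phi s p v) = 0) ->
  0 < c * \det (frame_mx phi s nu p) -> 0 < c * \det (frame_mx phi s nu' p) ->
  nu' = nu.
Proof.
move=> Exx Nx NN ND Nx' NN' ND' xD P P'.
have unit : frame_mx phi s nu p \in unitmx.
  by rewrite unitmxE unitfE; apply/eqP => E; rewrite E mulr0 ltxx in P.
have := frame_comb phi s nu p (nu' *m invmx (frame_mx phi s nu p)).
rewrite mulmxKV //; move: (nu' *m _) => u E.
have b0 : u 0 ord_max = 0.
  have := congr1 (mink (s p)) E.
  rewrite minkC Nx' !minkE xD Exx [mink (s p) nu]minkC Nx mulr0 mulrN1 !add0r => /esym /eqP.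
  by rewrite oppr_eq0 => /eqP.
move: E; rewrite b0 scale0r addr0.
set v := \row__ _; set a := u 0 _ => E.
have D0 : diff_in phi s p v = 0.
  have Dw : diff_in phi s p v = nu' - a *: nu by rewrite E addrK.
  apply: (mink_perp_eq0 Exx); first by rewrite minkC.
  by rewrite {1}Dw !minkE ND' ND mulr0 subr0.
rewrite D0 add0r in E.
have : a ^+ 2 = 1 by move: NN'; rewrite E !minkE NN mulr1 -expr2.
move/eqP; rewrite sqrf_eq1 => /orP[] /eqP a1.
  by rewrite E a1 scale1r.
move: P'; rewrite E a1 scaleN1r det_frame_oppr mulrN oppr_gt0 => P'.
by have := lt_trans P P'; rewrite ltxx.
Qed.

(** * Making a Lagrangian lift normal *)

(** Kernel vectors [v_k] of [cosh c *: A + sinh c *: B] for [n + 1] distinct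
    values of [c] would have images [B v_k] that are nonzero and pairwise
    orthogonal, hence the [v_k] would be linearly independent, in dimension
    [n]. *)
Lemma transverse_translate (R : realType) (n m : nat)
    (A B : {linear 'rV[R]_n -> 'rV[R]_m.+2}) x :
  mink x x = -1 -> (forall v, mink (B v) x = 0) ->
  (forall v w, mink (A v) (B w) = mink (B v) (A w)) ->
  (forall v, A v = 0 -> B v = 0 -> v = 0) ->
  exists c : R, forall v, cosh c *: A v + sinh c *: B v = 0 -> v = 0.
Proof.
move=> Exx Bx sym inj; apply: contrapT => /forallNP H.
have {}H (k : 'I_n.+1) : exists v, cosh (k%:R : R) *: A v + sinh (k%:R : R) *: B v = 0
    /\ v <> 0.
  by have /existsNP [v /not_implyP Hv] := H (k%:R : R); exists v.
have [v vP] := choice H.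
have C0 k : cosh (k%:R : R) != 0.
  by rewrite gt_eqF // (le_lt_trans _ (sinh_lt_cosh _)).
have B0 k : mink (B (v k)) (B (v k)) != 0.
  apply/negP => /eqP E; have B0 := mink_perp_eq0 Exx (Bx _) E.
  have [+ nv] := vP k; rewrite B0 scaler0 addr0 => /eqP.
  by rewrite scaler_eq0 (negbTE (C0 k)) => /eqP A0; apply: nv; exact: inj.
have orth k l : k != l -> mink (B (v k)) (B (v l)) = 0.
  move=> kl; have [Ek _] := vP k; have [El _] := vP l.
  have := congr1 (fun w => mink w (B (v l))) Ek.
  have := congr1 (fun w => mink (B (v k)) w) El.
  rewrite !minkE sym; set b := mink (B _) (B _); set m0 := mink (B _) (A _) => E1 E2.
  (* eliminate [m0] from [E1] and [E2] *)
  have S : sinh (k%:R - l%:R : R) * b = 0.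
    rewrite sinhD sinhN coshN.
    have -> : (sinh k%:R * cosh l%:R + cosh k%:R * - sinh l%:R) * b =
      cosh l%:R * (cosh k%:R * m0 + sinh k%:R * b)
      - cosh k%:R * (cosh l%:R * m0 + sinh l%:R * b) by ring.
    by rewrite E1 E2 !mulr0 subrr.
  move/eqP: S; rewrite mulf_eq0 => /orP[/eqP /sinh_eq0 /eqP|/eqP //].
  rewrite subr_eq0 eqr_nat => /eqP kl'.
  by move/eqP: kl; case; exact: val_inj.
pose P : 'M[R]_(n.+1, n) := \matrix_k v k.
have : kermx P != 0.
  rewrite -mxrank_eq0 mxrank_ker subn_eq0 -ltnNge ltnS.
  by rewrite rank_leq_col.
case/rowV0Pn => u /sub_kermxP uP u0.
move/eqP: u0; apply; apply/rowP => l; rewrite mxE.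
have E : \sum_k u 0 k *: v k = 0.
  by apply: etrans _ uP; rewrite mulmx_sum_row; apply: eq_bigr => k _; rewrite rowK.
have := congr1 (fun w => mink (B w) (B (v l))) E.
rewrite linear_sum linear0 mink0l.
have -> : mink (\sum_i B (u 0 i *: v i)) (B (v l)) = u 0 l * mink (B (v l)) (B (v l)).
  rewrite (big_morph _ (fun a b => minkDl a b (B (v l))) (mink0l (B (v l)))).
  rewrite (bigD1 l) //= big1 ?addr0 => [|k kl]; first by rewrite linearZ minkZl.
  by rewrite linearZ minkZl orth // mulr0.
by move/eqP; rewrite mulf_eq0 (negbTE (B0 l)) orbF => /eqP.
Qed.

Lemma diff_translate (R : realType) (U V : normedModType R)
    (a b : U -> V) (t : U -> R) z v :
  differentiable a z -> differentiable b z -> differentiable t z ->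
  'd (fun z => cosh (t z) *: a z + sinh (t z) *: b z) z v =
  ((sinh (t z) * 'd t z v) *: a z + cosh (t z) *: 'd a z v)
  + ((cosh (t z) * 'd t z v) *: b z + sinh (t z) *: 'd b z v).
Proof.
move=> da db dt.
have [dc ec] := diff_cosh v dt; have [ds es] := diff_sinh v dt.
have [d1 e1] := diff_scaleE v dc da; have [d2 e2] := diff_scaleE v ds db.
apply: etrans (diffDE v d1 d2) (etrans (congr2 +%R e1 e2) _).
exact: (congr2 (fun p q => (p *: a z + cosh (t z) *: 'd a z v)
  + (q *: b z + sinh (t z) *: 'd b z v)) ec es).
Qed.

Lemma liouville_flow_pointwise (R : realType) (n : nat) (x w p q : 'rV[R]_n.+2) (s k : R) :
  unit_tangent (x, w) -> mink p x = 0 -> mink q w = 0 -> mink p w + mink q x = 0 ->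
  mink (sinh s *: x + cosh s *: w)
    (((sinh s * k) *: x + cosh s *: p) + ((cosh s * k) *: w + sinh s *: q)) =
  k + mink w p.
Proof.
move=> [[/= Exx _] /= Exw Eww] px qw pw.
rewrite !minkE Exx Eww Exw (minkC w x) Exw (minkC x p) (minkC w q) px qw (minkC x q).
have -> : mink w p = - mink q x by rewrite (minkC w); lra.
apply: etrans (_ : (cosh s ^+ 2 - sinh s ^+ 2) * (k - mink q x) = _); first by ring.
by rewrite cosh_sq mul1r.
Qed.

(** The displacement along the geodesics contributes ['d t], the velocity
    being a unit vector; the flow for a fixed time preserves the Liouville
    form, as [mink a (db) = - mink b (da)]. *)
Lemma liouville_flow (R : realType) (n : nat) (U : normedModType R)
    (a b : U -> 'rV[R]_n.+2) (t : U -> R) z v :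
  differentiable a z -> differentiable b z -> differentiable t z ->
  (\forall z \near z, unit_tangent (a z, b z)) ->
  mink (sinh (t z) *: a z + cosh (t z) *: b z)
    ('d (fun z => cosh (t z) *: a z + sinh (t z) *: b z) z v) =
  'd t z v + mink (b z) ('d a z v).
Proof.
move=> da db dt UT.
have [p1 p2 p3] := tangent_pair v da db UT.
apply: etrans (congr1 (mink _) (diff_translate v da db dt)) _.
exact: liouville_flow_pointwise (nbhs_singleton UT) p1 p2 p3.
Qed.

(** The left-hand side of the equation is the differential of the base point
    of a lift translated by a function [t] equal to [c] at the given point,
    with [dt] opposite to the Liouville form: [p] and [q] stand for the
    differentials of the base point and of the velocity, and
    [transverse_translate] is applied to their components orthogonal to the
    flow. *)
Lemma transverse_lift (R : realType) (n m : nat)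
    (p q : {linear 'rV[R]_n -> 'rV[R]_m.+2}) x w :
  unit_tangent (x, w) -> (forall v, mink (p v) x = 0) -> (forall v, mink (q v) w = 0) ->
  (forall v, mink (p v) w + mink (q v) x = 0) ->
  (forall v u, mink (p v) (q u) = mink (q v) (p u)) ->
  (forall v k, p v = k *: w -> q v = k *: x -> v = 0) ->
  exists c : R, forall v,
    ((sinh c * - mink w (p v)) *: x + cosh c *: p v)
    + ((cosh c * - mink w (p v)) *: w + sinh c *: q v) = 0 -> v = 0.
Proof.
move=> [[/= Exx _] /= Exw Eww] px qw pqxw sym inj.
(* remove from the vectors [(p v, q v)] their components along the flow *)
have Alin : linear (fun v => p v - mink (p v) w *: w).
  move=> k u v; rewrite linearP minkDl minkZl scalerDl -scalerA scalerBr.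
  by rewrite opprD addrACA.
have Blin : linear (fun v => q v - mink (p v) w *: x).
  move=> k u v; rewrite !linearP minkDl minkZl scalerDl -scalerA scalerBr.
  by rewrite opprD addrACA.
pose A : {linear 'rV[R]_n -> 'rV[R]_m.+2} :=
  HB.pack (fun v => p v - mink (p v) w *: w) (GRing.isLinear.Build _ _ _ _ _ Alin).
pose B : {linear 'rV[R]_n -> 'rV[R]_m.+2} :=
  HB.pack (fun v => q v - mink (p v) w *: x) (GRing.isLinear.Build _ _ _ _ _ Blin).
have [v|v u|v A0 B0|c cP] := @transverse_translate _ _ _ A B x Exx.
- rewrite /B /= !minkE Exx mulrN1 opprK addrC; exact: pqxw.
- rewrite /A /B /= !minkE (minkC w (q u)) (minkC x (p u)) (minkC w x).
  by rewrite !px !qw !Exw sym; clear; ring.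
- apply: (inj v (mink (p v) w)); apply/eqP; rewrite -subr_eq0; apply/eqP.
    exact: A0.
  exact: B0.
exists c => v E; apply: cP; rewrite -[RHS]E /A /B /= (minkC w).
move: (p v) (q v) (mink (p v) w) => P Q k.
by apply/rowP => i; rewrite !mxE; ring.
Qed.

(** The Liouville form of a Lagrangian lift is closed, and its primitive
    tells by how much to move each base point for the velocity to become
    normal; the constant of integration is chosen by [transverse_lift] so
    that the base point is immersed at the centre of the ball. *)
Lemma normal_lift (R : realType) (n : nat) (z0 : 'rV[R]_n) (r : R)
    (a b : 'rV[R]_n -> 'rV[R]_n.+2) :
  0 < r -> smooth_on (ball z0 r) a -> smooth_on (ball z0 r) b ->
  (forall z, ball z0 r z -> unit_tangent (a z, b z)) ->
  (forall z X Y, ball z0 r z ->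
     mink ('d a z X) ('d b z Y) = mink ('d b z X) ('d a z Y)) ->
  (forall v k, 'd a z0 v = k *: b z0 -> 'd b z0 v = k *: a z0 -> v = 0) ->
  exists t : 'rV[R]_n -> R,
    let S := fun z => cosh (t z) *: a z + sinh (t z) *: b z in
    let N := fun z => sinh (t z) *: a z + cosh (t z) *: b z in
    [/\ smooth_on (ball z0 r) S, smooth_on (ball z0 r) N,
        forall z v, ball z0 r z -> mink (N z) ('d S z v) = 0 &
        forall v, 'd S z0 v = 0 -> v = 0].
Proof.
move=> r0 sa sb UT lag inj.
have oB : open (ball z0 r) by exact: ball_open.
have Bz0 : ball z0 r z0 by exact: ballxx.
have da z : ball z0 r z -> differentiable a z by exact: smooth_differentiable.
have db z : ball z0 r z -> differentiable b z by exact: smooth_differentiable.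
have nUT z : ball z0 r z -> \forall z \near z, unit_tangent (a z, b z).
  move=> Bz; have nB : \forall z \near z, ball z0 r z by apply: open_nbhs_nbhs.
  by apply: filterS nB => y; exact: UT.
pose al i z := mink (b z) ('D_(delta_mx 0 i) a z).
have sal i : smooth_on (ball z0 r) (al i).
  exact: smooth_mink oB sb (smooth_derive sa _).
have dDa z u : ball z0 r z -> differentiable ('D_u a) z.
  by move=> Bz; exact: smooth_differentiable (smooth_derive sa u) _ Bz.
have Dal z i v : ball z0 r z -> 'D_v (al i) z =
    mink ('d b z v) ('d a z (delta_mx 0 i)) + mink (b z) ('D_v ('D_(delta_mx 0 i) a) z).
  move=> Bz; have [d e] := diff_minkE v (db z Bz) (dDa z (delta_mx 0 i) Bz).
  apply: etrans (deriveE v d) (etrans e _).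
  exact: (congr2 (fun p q => mink _ p + mink _ q) (deriveE _ (da z Bz))
    (esym (deriveE v (dDa z _ Bz)))).
have [f fP] : exists f : 'rV[R]_n -> R, forall z, ball z0 r z ->
    differentiable f z /\ forall v, 'd f z v = \sum_i entry i v * al i z.
  apply: poincare => [i|i j z Bz]; first exact: sal.
  have T1 : mink ('d b z (delta_mx 0 j)) ('d a z (delta_mx 0 i))
      = mink ('d b z (delta_mx 0 i)) ('d a z (delta_mx 0 j)).
    exact: etrans (minkC _ _) (lag z _ _ Bz).
  have T2 := congr1 (mink (b z))
    (derive_comm_rV (delta_mx 0 i) (delta_mx 0 j) oB Bz (sa 2)).
  exact: (etrans (Dal z i (delta_mx 0 j) Bz)
    (etrans (congr2 +%R T1 T2) (esym (Dal z j (delta_mx 0 i) Bz)))).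
have df z : ball z0 r z -> differentiable f z by move=> /fP[].
have fE z v : ball z0 r z -> 'd f z v = mink (b z) ('d a z v).
  move=> Bz; have [_ ->] := fP z Bz.
  have -> : 'd a z v = \sum_i entry i v *: 'D_(delta_mx 0 i) a z.
    apply: etrans (linear_rV_sum ('d a z) v) _; apply: eq_bigr => i _.
    by congr (_ *: _); exact: (esym (deriveE _ (da z Bz))).
  rewrite (big_morph _ (fun x y => minkDr x y (b z)) (mink0r (b z))).
  by apply: eq_bigr => i _; rewrite minkZr.
have [c cP] : exists c : R, forall v,
    ((sinh c * - mink (b z0) ('d a z0 v)) *: a z0 + cosh c *: 'd a z0 v)
    + ((cosh c * - mink (b z0) ('d a z0 v)) *: b z0 + sinh c *: 'd b z0 v) = 0 ->
    v = 0.
  have tan v := tangent_pair v (da _ Bz0) (db _ Bz0) (nUT _ Bz0).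
  have P1 v : mink ('d a z0 v) (a z0) = 0 by case: (tan v).
  have P2 v : mink ('d b z0 v) (b z0) = 0 by case: (tan v).
  have P3 v : mink ('d a z0 v) (b z0) + mink ('d b z0 v) (a z0) = 0 by case: (tan v).
  exact: (transverse_lift (p := 'd a z0) (q := 'd b z0) (UT _ Bz0) P1 P2 P3
    (fun v u => lag z0 v u Bz0) inj).
(* normalized to be [c] at [z0], where [c] makes the base point immersed *)
pose t z := c + f z0 - f z.
have dt z : ball z0 r z -> differentiable t z.
  by move=> Bz; apply: differentiableB; [exact: differentiable_cst|exact: df].
have tE z v : ball z0 r z -> 'd t z v = - mink (b z) ('d a z v).
  move=> Bz; apply: etrans (diffBE v (differentiable_cst (c + f z0) z) (df z Bz)) _.
  apply: etrans (congr2 (fun p q => p - q) (diff_cstE _ _ _) (fE z v Bz)) _.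
  exact: sub0r.
have st : smooth_on (ball z0 r) t.
  apply: smooth_of_derive => // v k.
  have sm := smooth_opp oB (smooth_mink oB sb (smooth_derive sa v)).
  apply: Ck_ext (sm k) => // z Bz.
  apply: esym; apply: etrans (deriveE v (dt z Bz)) (etrans (tE z v Bz) _).
  by congr (- mink _ _); exact: (esym (deriveE v (da z Bz))).
have [sc ss] := smooth_cosh_sinh oB st.
exists t; split.
- by apply: smooth_add => //; exact: smooth_scale.
- by apply: smooth_add => //; exact: smooth_scale.
- move=> z v Bz; apply: etrans (liouville_flow v (da z Bz) (db z Bz) (dt z Bz) (nUT z Bz)) _.
  by rewrite tE // addNr.
- move=> v E; apply: cP; apply: etrans _ E.
  apply: etrans _ (esym (diff_translate v (da _ Bz0) (db _ Bz0) (dt _ Bz0))).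
  by rewrite tE // /t addrK.
Qed.

(** * Lagrangian immersions are locally Gauss maps *)

(** The domain is the open set where the determinant of the frame formed by
    the differential of the map, the normal field and the base point is
    nonzero, and the orientation of a chart is the sign of this determinant:
    with it the given normal field is the unit normal of the map. *)
Lemma gauss_of_normal_field (R : realType) (n : nat) (M : manifold R n)
    (phi1 : chart R M n) p (r : R) (S N : 'rV[R]_n -> 'rV[R]_n.+2) :
  atlas phi1 -> chart_dom phi1 p -> 0 < r ->
  ball (chart_map phi1 p) r `<=` chart_img phi1 ->
  smooth_on (ball (chart_map phi1 p) r) S -> smooth_on (ball (chart_map phi1 p) r) N ->
  (forall z, ball (chart_map phi1 p) r z -> unit_tangent (S z, N z)) ->
  (forall z v, ball (chart_map phi1 p) r z -> mink (N z) ('d S z v) = 0) ->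
  (forall v, 'd S (chart_map phi1 p) v = 0 -> v = 0) ->
  exists (U : set M) (sigma : M -> 'rV[R]_n.+2) (ori : chart R M n -> M -> R),
    [/\ open U, U p & orientation U ori] /\
    [/\ forall q, U q -> hyperbolic_space (sigma q),
        immersion (@atlas R n M) (@vector_atlas R n.+2) U sigma &
        forall q, U q -> [/\ chart_dom phi1 q, ball (chart_map phi1 p) r (chart_map phi1 q) &
          gauss_map ori sigma q = proj (S (chart_map phi1 q), N (chart_map phi1 q))]].
Proof.
set B := ball _ r => A1 d1 r0 Bi sS sN UT perp inj.
have H1 := manifold_charts A1.
have oB : open B by exact: ball_open.
have Bp : B (chart_map phi1 p) by exact: ballxx.
pose sigma q := S (chart_map phi1 q); pose nu q := N (chart_map phi1 q).
pose dom q := chart_dom phi1 q /\ B (chart_map phi1 q).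
have near_dom q : dom q -> \forall q' \near q, dom q'.
  by move=> [dq Bq]; apply: near_chart_map => //; apply: open_nbhs_nbhs.
have sE q : dom q -> \forall z \near chart_map phi1 q, S z = (sigma \o chart_inv phi1) z.
  move=> [dq Bq]; have nB : \forall z \near chart_map phi1 q, B z by apply: open_nbhs_nbhs.
  apply: filterS nB => z Bz; rewrite /sigma /=.
  by have [_ ->] := chart_invP H1 (Bi _ Bz).
have dsig q : dom q -> differentiable (sigma \o chart_inv phi1) (chart_map phi1 q) /\
    forall v, diff_in phi1 sigma q v = 'd S (chart_map phi1 q) v.
  move=> dq; have [_ Bq] := dq.
  have [D E] := near_differentiable (sE q dq) (smooth_differentiable sS Bq).
  by split=> [|v]; [exact: D|exact: (congr1 (@^~ v) E)].
have dsigE phi q : atlas phi -> chart_dom phi q -> dom q ->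
    differentiable (sigma \o chart_inv phi) (chart_map phi q) /\
    forall v, diff_in phi sigma q v =
      diff_in phi1 sigma q ('d (transition phi phi1) (chart_map phi q) v).
  move=> Aphi dphi dq; have [dq1 _] := dq; have [D _] := dsig q dq.
  exact: (diff_change_chart Aphi A1 dphi dq1 D).
have UTq q : dom q -> unit_tangent (sigma q, nu q) by move=> [_ Bq]; exact: UT.
have perp_nu phi q v : atlas phi -> chart_dom phi q -> dom q ->
    mink (nu q) (diff_in phi sigma q v) = 0.
  move=> Aphi dphi dq; have [_ E1] := dsigE phi q Aphi dphi dq.
  have [_ E2] := dsig q dq; have [_ Bq] := dq.
  pose w := 'd (transition phi phi1) (chart_map phi q) v.
  have E3 := congr1 (mink (nu q)) (etrans (E1 v) (E2 w)).
  exact (etrans E3 (perp _ w Bq)).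
have perp_sigma phi q v : atlas phi -> chart_dom phi q -> dom q ->
    mink (sigma q) (diff_in phi sigma q v) = 0.
  move=> Aphi dphi dq; have [_ E1] := dsigE phi q Aphi dphi dq.
  have [_ E2] := dsig q dq; have [_ Bq] := dq.
  have nUT : \forall z \near chart_map phi1 q, unit_tangent (S z, N z).
    have nB : \forall z \near chart_map phi1 q, B z by apply: open_nbhs_nbhs.
    by apply: filterS nB => z; exact: UT.
  have [E _ _] := tangent_pair ('d (transition phi phi1) (chart_map phi q) v)
    (smooth_differentiable sS Bq) (smooth_differentiable sN Bq) nUT.
  exact: etrans (congr1 (mink (sigma q)) (etrans (E1 v) (E2 _))) (etrans (minkC _ _) E).
pose D phi q := \det (frame_mx phi sigma (nu q) q).
have DE phi q : atlas phi -> chart_dom phi q -> dom q ->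
    D phi q = \det ('J (transition phi phi1) (chart_map phi q)) * D phi1 q.
  move=> Aphi dphi dq; have [dq1 _] := dq; have [ds _] := dsig q dq.
  exact: (det_frame_change _ Aphi A1 dphi dq1 ds).
have cD q : dom q -> D phi1 q' @[q' --> q] --> D phi1 q.
  move=> dq; apply: cvg_det => i j; have [dq1 Bq] := dq.
  have cphi : chart_map phi1 q' @[q' --> q] --> chart_map phi1 q.
    by move=> P nP; apply: filterS (near_chart_map H1 dq1 nP) => q' [].
  have c_entry (f : 'rV[R]_n -> 'rV[R]_n.+2) : {for chart_map phi1 q, continuous f} ->
      entry j (f (chart_map phi1 q')) @[q' --> q] --> entry j (f (chart_map phi1 q)).
    by move=> cf; exact: (cvg_comp _ _ (cvg_comp _ _ cphi cf) (@entry_continuous R _ j _)).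
  case: (unliftP ord_max i) => [i'|] Ei.
    case: (unliftP ord_max i') => [k|] Ei'.
      have E q' : dom q' -> frame_mx phi1 sigma (nu q') q' i j
          = entry j ('D_(delta_mx 0 k) S (chart_map phi1 q')).
        move=> dq'; rewrite mxE Ei liftK Ei' liftK /entry; congr (fun_of_matrix _ 0 j).
        have [_ E1] := dsig q' dq'; have [_ Bq'] := dq'.
        have E2 := deriveE (delta_mx 0 k) (smooth_differentiable sS Bq').
        exact (etrans (E1 (delta_mx 0 k)) (esym E2)).
      apply: (near_eq_cvg_to _ (E q dq)
        (c_entry _ (smooth_continuous (smooth_derive sS (delta_mx 0 k)) Bq))).
      by apply: filterS (near_dom q dq) => q'; exact: E.
    have E q' : frame_mx phi1 sigma (nu q') q' i j = entry j (N (chart_map phi1 q')).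
      by rewrite mxE Ei liftK Ei' unlift_none.
    by apply: (near_eq_cvg_to _ (E q) (c_entry _ (smooth_continuous sN Bq))); exact: nearW.
  have E q' : frame_mx phi1 sigma (nu q') q' i j = entry j (S (chart_map phi1 q')).
    by rewrite mxE Ei unlift_none.
  by apply: (near_eq_cvg_to _ (E q) (c_entry _ (smooth_continuous sS Bq))); exact: nearW.
have frame_inj phi q : atlas phi -> chart_dom phi q -> dom q ->
    D phi q != 0 <-> (forall v, diff_in phi sigma q v = 0 -> v = 0).
  move=> Aphi dphi dq; apply: det_frame_neq0; first exact: UTq.
    by move=> v; exact: perp_nu.
  by move=> v; exact: perp_sigma.
have domp : dom p by split.
pose U := [set q | dom q /\ D phi1 q != 0].
have Up : U p.
  split; first exact: domp.
  apply/(frame_inj phi1 p A1 d1 domp) => v E; have [_ E1] := dsig p domp.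
  exact: inj (etrans (esym (E1 v)) E).
have D0 phi q : atlas phi -> chart_dom phi q -> U q -> D phi q != 0.
  move=> Aphi dphi [dq D1]; rewrite DE // mulf_neq0 //.
  by case: dq => dq1 _; exact: transition_det_neq0.
pose ori phi q := Num.sg (D phi q).
have oU : open U.
  rewrite openE => q [dq Dq]; apply: filterI; first exact: near_dom.
  by apply: (cvgr_neq0 _ (cD q dq)).
exists U, sigma, ori; split; split.
- exact: oU.
- exact: Up.
- split=> [phi q Aphi [dq Dq] dphi|phi q Aphi Uq dphi|phi psi q Aphi Apsi [dq Dq] dphi dpsi].
  + have := D0 phi q Aphi dphi (conj dq Dq); rewrite /ori neq_lt => /orP[h|h].
      by right; rewrite ltr0_sg.
    by left; rewrite gtr0_sg.
  + have [dq Dq] := Uq; have [dq1 _] := dq.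
    have n1 : \forall q' \near q,
        Num.sg (\det ('J (transition phi phi1) (chart_map phi q'))) =
        Num.sg (\det ('J (transition phi phi1) (chart_map phi q))).
      exact: sg_near (transition_det_cvg Aphi A1 dphi dq1)
        (transition_det_neq0 Aphi A1 dphi dq1).
    have n2 : \forall q' \near q, Num.sg (D phi1 q') = Num.sg (D phi1 q).
      exact: sg_near (cD q dq) Dq.
    have n3 : \forall q' \near q, chart_dom phi q'.
      by have [od _ _ _ _] := manifold_charts Aphi; apply: open_nbhs_nbhs.
    apply: filterS (filterI (filterI n1 n2) (filterI n3 (near_dom q dq))).
    move=> q' [[e1 e2] [d2 dq']]; rewrite /ori (DE phi q' Aphi d2 dq').
    rewrite (DE phi q Aphi dphi dq) !sgrM.
    exact: (congr2 (fun x y : R => x * y) e1 e2).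
  + have [ds _] := dsigE psi q Apsi dpsi dq.
    rewrite /ori -sgrM; congr (Num.sg _).
    exact: det_frame_change.
- by move=> q [dq _]; have [] := UTq q dq.
- split=> [q [[dq1 Bq] _]|q phi psi Uq Aphi Vpsi dphi _].
    exists phi1, (Chart setT id id), B; split=> //; split=> //.
    move=> k; apply: Ck_ext (sS k) => // z Bz; rewrite /local_rep /sigma /=.
    by have [_ ->] := chart_invP H1 (Bi _ Bz).
  have E : tangent_map phi psi sigma q = diff_in phi sigma q by rewrite Vpsi.
  have [dq _] := Uq; have K := (frame_inj phi q Aphi dphi dq).1 (D0 phi q Aphi dphi Uq).
  rewrite E => v w vw; apply/eqP; rewrite -subr_eq0; apply/eqP; apply: K.
  by apply: etrans (linearB _ _ _) _; apply/eqP; rewrite subr_eq0; apply/eqP.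
- move=> q Uq; have [dq Dq] := Uq; have [dq1 Bq] := dq; split=> //.
  rewrite /gauss_map; congr (proj (_, _)).
  have [[/= Exx _] /= Exv Evv] := UTq q dq.
  have P : [set nu | [/\ mink nu (sigma q) = 0, mink nu nu = 1 &
      forall phi, atlas phi -> chart_dom phi q ->
        (forall X, mink nu (diff_in phi sigma q X) = 0) /\
        0 < ori phi q * \det (frame_mx phi sigma nu q)]] (nu q).
    split=> [|//|phi Aphi dphi]; first by rewrite minkC.
    split=> [X|]; first exact: perp_nu.
    by rewrite -/(D phi q) /ori -normrEsg normr_gt0; exact: D0.
  have [Nx NN spec] := P; have [Nx' NN' spec'] := xgetI 0 P.
  have [ND P1] := spec phi1 A1 dq1; have [ND' P1'] := spec' phi1 A1 dq1.
  exact: (unit_normal_unique Exx Nx NN ND Nx' NN' ND'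
    (fun v => perp_sigma phi1 q v A1 dq1 dq) P1 P1').
Qed.

(** The joint kernel of the differentials of the two components of a lift,
    modulo the flow, is killed by the differential of [G], hence trivial;
    this is the hypothesis of [normal_lift] that comes from [G] being an
    immersion. *)
Lemma gauss_of_lagrangian (R : realType) (n : nat) (M : manifold R n)
    (G : M -> set ('rV[R]_n.+2 * 'rV[R]_n.+2)) p :
  immersion (@atlas R n M) (@geodesic_atlas R n) setT G -> lagrangian G ->
  exists (U : set M) (sigma : M -> 'rV[R]_n.+2) (ori : chart R M n -> M -> R),
    [/\ open U, U p & orientation U ori] /\
    [/\ forall q, U q -> hyperbolic_space (sigma q),
        immersion (@atlas R n M) (@vector_atlas R n.+2) U sigma &
        forall q, U q -> gauss_map ori sigma q = G q].
Proof.
move=> [sG iG] lagG.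
have [phi [psi [r [lft [[Aphi Apsi dphi r0] [Bi sg sl lP]]]]]] := local_lift p sG.
have Hphi := manifold_charts Aphi.
set z0 := chart_map phi p in Bi sg sl lP.
have oB : open (ball z0 r) by exact: ball_open.
have Bz0 : ball z0 r z0 by exact: ballxx.
have Kphi : chart_inv phi z0 = p by case: Hphi => _ _ _ _; exact.
pose a z := (lft z).1; pose b z := (lft z).2.
have lE z : (a z, b z) = lft z by rewrite /a /b; case: (lft z).
have sa : smooth_on (ball z0 r) a.
  by move=> k; apply: (Ck_lin (L := fst)) (sl k) => // y; exact: cvg_fst.
have sb : smooth_on (ball z0 r) b.
  by move=> k; apply: (Ck_lin (L := snd)) (sl k) => // y; exact: cvg_snd.
have dl z : ball z0 r z -> differentiable lft z by exact: smooth_differentiable.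
have nB z : ball z0 r z -> \forall y \near z, ball z0 r y.
  by move=> Bz; apply: open_nbhs_nbhs.
have UT z : ball z0 r z -> unit_tangent (a z, b z).
  by move=> /lP[U _ _]; rewrite lE.
have lag z X Y : ball z0 r z ->
    mink ('d a z X) ('d b z Y) = mink ('d b z X) ('d a z Y).
  move=> Bz; have [_ pE dom] := lP z Bz.
  have [dq qz] := chart_invP Hphi (Bi _ Bz).
  have dpsi : chart_dom psi (proj (lft z)) by rewrite pE.
  have nUT : \forall y \near z, unit_tangent (lft y).
    by apply: filterS (nB z Bz) => y /lP[].
  have gE : \forall y \near z, local_rep phi psi G y = chart_map psi (proj (lft y)).
    by apply: filterS (nB z Bz) => y /lP[_ -> _].
  have PS := para_symplectic_lift X Y Apsi dpsi (dl z Bz) nUT gE.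
  have L0 := lagG _ phi psi Aphi Apsi dq dom X Y.
  rewrite /tangent_map qz -pE in L0.
  have om := etrans (esym PS) L0.
  have ea v : 'd a z v = ('d lft z v).1 by exact: diff_fstE (dl z Bz).
  have eb v : 'd b z v = ('d lft z v).2 by exact: diff_sndE (dl z Bz).
  have E1 := congr2 (@mink R n) (ea X) (eb Y).
  have E2 := congr2 (@mink R n) (eb X) (ea Y).
  apply: etrans E1 (etrans _ (esym E2)).
  exact: (subr0_eq om).
have inj v k : 'd a z0 v = k *: b z0 -> 'd b z0 v = k *: a z0 -> v = 0.
  move=> ev eu; have [_ pE dom] := lP z0 Bz0.
  rewrite Kphi in pE dom.
  have dpsi : chart_dom psi (proj (lft z0)) by rewrite pE.
  have Uz0 : unit_tangent (lft z0) by have [] := lP z0 Bz0.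
  have [_ [lift _]] := Apsi; have [OO [F [ext _]]] := lift _ Uz0 dpsi.
  have [oO Oz0 sF FE] := ext; have dF := smooth_differentiable sF Oz0.
  have gE : \forall y \near z0, (F \o lft) y = local_rep phi psi G y.
    have nO : \forall y \near z0, OO (lft y).
      by apply: (differentiable_continuous (dl z0 Bz0)); apply: open_nbhs_nbhs.
    apply: filterS (filterI nO (nB z0 Bz0)) => y [Oy By].
    by have [Uy py _] := lP y By; rewrite /= (FE _ Oy Uy) /= py.
  have [_ dgE] := near_differentiable gE (differentiable_comp (dl z0 Bz0) dF).
  have dlv : 'd lft z0 v = k *: ((lft z0).2, (lft z0).1).
    apply: injective_projections.
      exact: etrans (esym (diff_fstE v (dl z0 Bz0))) ev.
    exact: etrans (esym (diff_sndE v (dl z0 Bz0))) eu.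
  have T0 : tangent_map phi psi G p v = 0.
    apply: etrans (congr1 (@^~ v) dgE) _.
    apply: etrans (diff_compE v (dl z0 Bz0) dF) _.
    apply: etrans (congr1 ('d F (lft z0)) dlv) _.
    have Z1 : 'd F (lft z0) (k *: ((lft z0).2, (lft z0).1))
        = k *: 'd F (lft z0) ((lft z0).2, (lft z0).1) by exact: linearZ.
    apply: etrans Z1 (etrans (congr1 ( *:%R k) (extension_flow Uz0 ext)) _).
    exact: scaler0.
  apply: (iG p phi psi I Aphi Apsi dphi dom).
  by apply: etrans T0 (esym _); exact: linear0.
have [t [sS sN perp injS]] := normal_lift r0 sa sb UT lag inj.
have flowE z : (cosh (t z) *: a z + sinh (t z) *: b z,
    sinh (t z) *: a z + cosh (t z) *: b z) = geodesic_flow (t z) (lft z) by [].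
have UTS z : ball z0 r z -> unit_tangent (cosh (t z) *: a z + sinh (t z) *: b z,
    sinh (t z) *: a z + cosh (t z) *: b z).
  by move=> /lP[U _ _]; rewrite flowE; exact: unit_tangent_flow.
have [U [sigma [ori [HU [hyp imm gauss]]]]] :=
  gauss_of_normal_field Aphi dphi r0 Bi sS sN UTS perp injS.
exists U, sigma, ori; split; first exact: HU.
split; [exact: hyp|exact: imm|move=> q Uq].
have [dq Bq gq] := gauss q Uq.
rewrite gq flowE proj_flow; have [_ -> _] := lP _ Bq.
by congr (G _); case: Hphi => _ _ _ _; exact.
Qed.

Theorem theorem10p3p4 (R : realType) (n : nat) (M : manifold R n)
    (G : M -> set ('rV[R]_n.+2 * 'rV[R]_n.+2))
    (G_geodesic : forall p, geodesics (G p))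
    (G_immersion : immersion (@atlas R n M) (@geodesic_atlas R n) setT G) :
  lagrangian G <->
  forall p : M, exists (U : set M) (sigma : M -> 'rV[R]_n.+2)
      (o : chart R M n -> M -> R),
    [/\ open U, U p & orientation U o] /\
    [/\ forall q, U q -> hyperbolic_space (sigma q),
        immersion (@atlas R n M) (@vector_atlas R n.+2) U sigma &
        forall q, U q -> gauss_map o sigma q = G q].
Proof.
split=> [lagG p|HG]; first exact: gauss_of_lagrangian.
have [sG _] := G_immersion.
apply: (lagrangian_of_gauss G_geodesic sG) => p.
have [U [sigma [ori [[oU Up _] [_ [ssig _] gauss]]]]] := HG p.
by exists U, sigma, ori.
Qed.
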